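(* Let $\Lambda=K\Gamma/I$ be a triangular monomial algebra with Jacobson radical $J$, and let $U$ be a uniserial left $\Lambda$-module with mast $p=\alpha_{n-1}\cdots\alpha_1$, where $\alpha_i\colon i\to i+1$. Then the following statements are equivalent: (1) The embedding $JU\hookrightarrow U$ is irreducible. (2) $U$ is not simple and satisfies both (a) and (b) below: (a) (i) for every $\beta\in B$, $\ \beta\alpha_{\mathrm{s}(\beta)-1}\cdots\alpha_1=0$, and (ii) for every $\delta\in D$, $\ \delta\alpha_{\mathrm{s}(\delta)-1}\cdots\alpha_1=0$. (b) For every $\beta'\in B'$ such that $\beta'p\neq0$: (i) for every $\gamma\in C$, $\ \beta'\alpha_{n-1}\cdots\alpha_{\mathrm{t}(\gamma)}\gamma=0$, and (ii) for every $\delta\in D$, $\ \beta'\alpha_{n-1}\cdots\alpha_{\mathrm{t}(\delta)}\delta=0$. (All equalities are in $\Lambda$.)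
   Context: $K$ is a field, $\Gamma$ a finite quiver with vertex set $\Gamma_0$ and arrow set $\Gamma_1$, $I$ an admissible ideal of the path algebra $K\Gamma$, and $\Lambda=K\Gamma/I$ is finite-dimensional; modules are finitely generated left modules. $\Lambda$ is monomial if $I$ is generated by paths, and triangular if $\Gamma$ has no directed cycles. Paths and maps are composed from right to left; $\mathrm{s}(q)$ and $\mathrm{t}(q)$ are the starting and end points of a path $q$. Vertices and paths are identified with their classes in $\Lambda$ where useful. A module is uniserial if it has only one composition series with simple factors. If $U$ is uniserial of length $n$, a mast of $U$ is a path $p$ in $\Gamma$ of length $n-1$ such that $px\neq0$ for some $x\in U$. The vertices passed by $p$ are named $1,\dots,n$, so $p=1\xrightarrow{\alpha_1}2\xrightarrow{\alpha_2}\cdots\xrightarrow{\alpha_{n-1}}n$. An expression $\alpha_i\cdots\alpha_j$ with $i<j$ stands for $1$. Define $B=\{\beta\in\Gamma_1\mid \mathrm{s}(\beta)\in\{1,\dots,n-1\},\ \mathrm{t}(\beta)\notin\{1,\dots,n\}\}$, $B'=\{\beta'\in\Gamma_1\mid \mathrm{s}(\beta')=n\}$, $C=\{\gamma\in\Gamma_1\mid \mathrm{s}(\gamma)\notin\{1,\dots,n\},\ \mathrm{t}(\gamma)\in\{2,\dots,n\}\}$, $D=\{\delta\in\Gamma_1\mid \{\mathrm{s}(\delta),\mathrm{t}(\delta)\}\subset\{1,\dots,n\},\ \delta\notin\{\alpha_1,\dots,\alpha_{n-1}\}\}$. A map $f$ of finitely generated modules is irreducible if it is neither a split monomorphism nor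 a split epimorphism and $f=gh$ implies that $h$ is a split monomorphism or $g$ is a split epimorphism. *)

(* Defs.v *)
From HB Require Import structures.
From mathcomp Require Import all_boot all_algebra.
From mathcomp Require Import boolp finmap monalg.

Set Implicit Arguments.
Unset Strict Implicit.
Unset Printing Implicit Defensive.

Import GRing.Theory.
Local Open Scope ring_scope.
Local Open Scope quotient_scope.

Record quiver := Quiver {
  vertex : finType;
  arrow : finType;
  src : arrow -> vertex;
  tgt : arrow -> vertex
}.

(* A path is a start vertex together with the arrows in the order in which they
   are traversed: the path written alpha_k ... alpha_1 in the right-to-left
   convention has arrow list [:: alpha_1; ...; alpha_k].  The path of length 0
   at v is (v, [::]).                                                         *)
Section Paths.
Variable Gamma : quiver.

Fixpoint is_walk (v : vertex Gamma) (s : seq (arrow Gamma)) : bool :=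
  if s is a :: s' then (src a == v) && is_walk (tgt a) s' else true.

Record qpath := QPath {
  qpath_val :> vertex Gamma * seq (arrow Gamma);
  _ : is_walk qpath_val.1 qpath_val.2
}.

HB.instance Definition _ := [isSub for qpath_val].
HB.instance Definition _ := [Choice of qpath by <:].

Definition pstart (p : qpath) : vertex Gamma := p.1.
Definition parrows (p : qpath) : seq (arrow Gamma) := p.2.
Definition plen (p : qpath) : nat := size (parrows p).
Definition pverts (p : qpath) : seq (vertex Gamma) :=
  pstart p :: [seq tgt a | a <- parrows p].
Definition pend (p : qpath) : vertex Gamma :=
  last (pstart p) [seq tgt a | a <- parrows p].

Definition vpath (v : vertex Gamma) : qpath := @QPath (v, [::]) isT.

Fact arrow_walk (a : arrow Gamma) : is_walk (src a) [:: a].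
Proof. by rewrite /= eqxx. Qed.
Definition apath (a : arrow Gamma) : qpath := @QPath (src a, [:: a]) (arrow_walk a).

(* The composition "q after p", undefined unless p ends where q starts. *)
Definition pcomp (q p : qpath) : option qpath :=
  if pend p == pstart q then insub (pstart p, parrows p ++ parrows q) else None.

Definition triangular : Prop :=
  forall p : qpath, pstart p = pend p -> plen p = 0%N.

Lemma is_walk_cat v s t :
  is_walk v (s ++ t) = is_walk v s && is_walk (last v [seq tgt a | a <- s]) t.
Proof. by elim: s v => //= a s IHs v; rewrite IHs andbA. Qed.

Variant pcomp_spec (q p : qpath) : bool -> option qpath -> Prop :=
| PComp r of pend p = pstart q & pstart r = pstart p & pend r = pend q
    & parrows r = parrows p ++ parrows q : pcomp_spec q p true (Some r)
| PCompNone of pend p != pstart q : pcomp_spec q p false None.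

Lemma pcompP q p : pcomp_spec q p (pend p == pstart q) (pcomp q p).
Proof.
rewrite /pcomp; case: (boolP (pend p == pstart q)) => e; last by constructor.
have w : is_walk (pstart p) (parrows p ++ parrows q).
  rewrite is_walk_cat; apply/andP; split; first exact: (valP p).
  by move: e; rewrite /pend => /eqP->; apply: (valP q).
rewrite (@insubT _ (fun x => is_walk x.1 x.2) _
  (pstart p, parrows p ++ parrows q) w).
constructor=> //; first exact/eqP.
by move/eqP: e; rewrite /pend /parrows /pstart /= map_cat last_cat => ->.
Qed.

Lemma qpath_eq (p q : qpath) : pstart p = pstart q -> parrows p = parrows q -> p = q.
Proof.
move=> h1 h2; apply: val_inj; move: h1 h2; rewrite /pstart /parrows /=.
by case: (qpath_val p) (qpath_val q) => [? ?] [? ?] /= -> ->.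
Qed.

Lemma pcompA r q p :
  obind (pcomp r) (pcomp q p) = obind (fun s => pcomp s p) (pcomp r q).
Proof.
case: (pcompP q p) => [u e1 e2 e3 e4|ne1] /=; case: (pcompP r q) => [w f1 f2 f3 f4|ne2] //=.
- case: (pcompP r u) => [x g1 g2 g3 g4|/eqP[]]; last by rewrite e3.
  case: (pcompP w p) => [y h1 h2 h3 h4|/eqP[]]; last by rewrite f2.
  congr Some; apply: qpath_eq; first by rewrite g2 h2.
  by rewrite g4 h4 e4 f4 catA.
- by case: (pcompP r u) => // x; rewrite e3 => /eqP; rewrite (negbTE ne2).
- by case: (pcompP w p) => // x; rewrite f2 => /eqP; rewrite (negbTE ne1).
Qed.

Lemma pcomp_vr v p : pcomp p (vpath v) = if pstart p == v then Some p else None.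
Proof.
have ev : pend (vpath v) = v by [].
case: (pcompP p (vpath v)) => [r e1 e2 e3 e4|]; last first.
  by rewrite ev eq_sym => /negbTE->.
by rewrite -e1 ev eqxx; congr Some; apply: qpath_eq; rewrite ?e4 // e2 -e1.
Qed.

Lemma pcomp_vl v p : pcomp (vpath v) p = if pend p == v then Some p else None.
Proof.
rewrite -[v in RHS]/(pstart (vpath v)).
case: (pcompP (vpath v) p) => [r e1 e2 e3 e4|//].
by congr Some; apply: qpath_eq; rewrite ?e4 // cats0.
Qed.

End Paths.

(* The path algebra K Gamma: the free K-module on the paths, with product
   induced by composition of paths (zero when not composable); its unit is the
   sum of the vertices.  It may be the zero ring (no vertices), hence pzRing. *)
Definition path_algebra (K : fieldType) (Gamma : quiver) : Type :=
  {malg K[qpath Gamma]}.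

HB.lock Definition path_elt (K : fieldType) (Gamma : quiver) (p : qpath Gamma) :
  path_algebra K Gamma := << p >>.
Arguments path_elt K {Gamma} p.
Canonical path_elt_unlockable := Unlockable path_elt.unlock.

HB.instance Definition _ (K : fieldType) (Gamma : quiver) :=
  GRing.Lmodule.on (path_algebra K Gamma).

Definition pcomp_elt (K : fieldType) (Gamma : quiver) (q p : qpath Gamma) :
  path_algebra K Gamma := oapp (path_elt K) 0 (pcomp q p).

HB.lock Definition pa_mul (K : fieldType) (Gamma : quiver)
    (x y : path_algebra K Gamma) : path_algebra K Gamma :=
  \sum_(q <- msupp x) \sum_(p <- msupp y) (x@_q * y@_p) *: pcomp_elt K q p.
Arguments pa_mul {K Gamma} x y.
Canonical pa_mul_unlockable := Unlockable pa_mul.unlock.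

Section PathAlgebra.
Variables (K : fieldType) (Gamma : quiver).
Local Notation P := (qpath Gamma).
Local Notation A := (path_algebra K Gamma).
Local Notation pcomp_elt := (pcomp_elt K).
Local Notation pa_mul := (@pa_mul K Gamma).
Local Notation path_elt := (path_elt K).


Definition pa_one : A := \sum_(v : vertex Gamma) path_elt (vpath v).

Lemma pa_mulw (d1 d2 : {fset P}) (x y : A) :
  (msupp x `<=` d1)%fset -> (msupp y `<=` d2)%fset ->
  pa_mul x y = \sum_(q <- d1) \sum_(p <- d2) (x@_q * y@_p) *: pcomp_elt q p.
Proof.
move=> le1 le2; rewrite unlock (big_fset_incl _ le1) /=.
  apply: eq_bigr => q _; apply: big_fset_incl => // p _ /mcoeff_outdom ->.
  by rewrite mulr0 scale0r.
by move=> q _ /mcoeff_outdom xq; rewrite big1 // => p _; rewrite xq mul0r scale0r.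
Qed.

Lemma pa_mulDl : left_distributive pa_mul +%R.
Proof.
move=> x y z; have s := fsubset_refl (msupp z).
rewrite (pa_mulw (msuppD_le x y) s) (pa_mulw (fsubsetUl (msupp x) (msupp y)) s).
rewrite (pa_mulw (fsubsetUr (msupp x) (msupp y)) s) -big_split; apply: eq_bigr => q _ /=.
rewrite -big_split; apply: eq_bigr => p _ /=.
by rewrite mcoeffD mulrDl scalerDl.
Qed.

Lemma pa_mulDr : right_distributive pa_mul +%R.
Proof.
move=> z x y; have s := fsubset_refl (msupp z).
rewrite (pa_mulw s (msuppD_le x y)) (pa_mulw s (fsubsetUl (msupp x) (msupp y))).
rewrite (pa_mulw s (fsubsetUr (msupp x) (msupp y))) -big_split; apply: eq_bigr => q _ /=.
rewrite -big_split; apply: eq_bigr => p _ /=.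
by rewrite mcoeffD mulrDr scalerDl.
Qed.

Lemma pa_scaleAl k x y : k *: pa_mul x y = pa_mul (k *: x) y.
Proof.
rewrite (pa_mulw (fsubset_refl (msupp x)) (fsubset_refl (msupp y))).
rewrite (pa_mulw (msuppZ_le k x) (fsubset_refl (msupp y))) scaler_sumr.
apply: eq_bigr => q _; rewrite scaler_sumr; apply: eq_bigr => p _.
by rewrite mcoeffZ scalerA mulrA.
Qed.

Lemma pa_scaleAr k x y : k *: pa_mul x y = pa_mul x (k *: y).
Proof.
rewrite (pa_mulw (fsubset_refl (msupp x)) (fsubset_refl (msupp y))).
rewrite (pa_mulw (fsubset_refl (msupp x)) (msuppZ_le k y)) scaler_sumr.
apply: eq_bigr => q _; rewrite scaler_sumr; apply: eq_bigr => p _.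
by rewrite mcoeffZ scalerA mulrCA.
Qed.

Lemma pa_mulUU q p : pa_mul (path_elt q) (path_elt p) = pcomp_elt q p.
Proof.
by rewrite path_elt.unlock (pa_mulw msuppU_le msuppU_le) !big_seq_fset1 !mcoeffUU mulr1 scale1r.
Qed.

Lemma pa_mul0x : left_zero 0 pa_mul.
Proof. by move=> x; rewrite -[0 in LHS](scale0r 0) -pa_scaleAl scale0r. Qed.
Lemma pa_mulx0 : right_zero 0 pa_mul.
Proof. by move=> x; rewrite -[0 in LHS](scale0r 0) -pa_scaleAr scale0r. Qed.

Lemma path_eltE (x : A) : x = \sum_(p <- msupp x) x@_p *: path_elt p.
Proof.
rewrite {1}[x]monalgE; apply: eq_bigr => p _; apply/malgP => q.
by rewrite path_elt.unlock mcoeffZ !mcoeffU mulrnAr mulr1.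
Qed.

Lemma pa_ind (Q : A -> Prop) :
  Q 0 -> (forall x y, Q x -> Q y -> Q (x + y)) ->
  (forall k p, Q (k *: path_elt p)) -> forall x, Q x.
Proof. by move=> h0 hD hU x; rewrite [x]path_eltE; elim/big_rec: _ => // p y _; apply: hD. Qed.

Lemma pa_mulUUA r q p :
  pa_mul (path_elt r) (pcomp_elt q p) = pa_mul (pcomp_elt r q) (path_elt p).
Proof.
rewrite /pcomp_elt; have := pcompA r q p.
case: (pcomp q p) (pcomp r q) => [u|] [w|] /= e;
  rewrite ?pa_mul0x ?pa_mulx0 ?pa_mulUU /pcomp_elt ?e //.
by rewrite -e.
Qed.

Lemma pa_mulA : associative pa_mul.
Proof.
move=> x y z; elim/pa_ind: x => [|x1 x2 h1 h2|k r].
- by rewrite !pa_mul0x.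
- by rewrite !pa_mulDl h1 h2.
rewrite -(pa_scaleAl k (path_elt r) (pa_mul y z)) -(pa_scaleAl k (path_elt r) y).
rewrite -(pa_scaleAl k (pa_mul (path_elt r) y) z); congr (_ *: _).
elim/pa_ind: y => [|x1 x2 h1 h2|l q].
- by rewrite pa_mulx0 !pa_mul0x pa_mulx0.
- by rewrite pa_mulDr !pa_mulDl pa_mulDr h1 h2.
rewrite -(pa_scaleAl l (path_elt q) z) -(pa_scaleAr l (path_elt r)).
rewrite -(pa_scaleAr l (path_elt r) (path_elt q)).
rewrite -(pa_scaleAl l (pa_mul (path_elt r) (path_elt q)) z); congr (_ *: _).
elim/pa_ind: z => [|x1 x2 h1 h2|m p].
- by rewrite !pa_mulx0.
- by rewrite !pa_mulDr h1 h2.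
rewrite -(pa_scaleAr m (path_elt q) (path_elt p)).
rewrite -(pa_scaleAr m (path_elt r) (pa_mul (path_elt q) (path_elt p))).
rewrite -(pa_scaleAr m (pa_mul (path_elt r) (path_elt q)) (path_elt p)).
by rewrite !pa_mulUU pa_mulUUA.
Qed.

Lemma pa_mul1x : left_id pa_one pa_mul.
Proof.
elim/pa_ind => [|x y hx hy|k p].
- by rewrite pa_mulx0.
- by rewrite pa_mulDr hx hy.
rewrite -(pa_scaleAr k pa_one (path_elt p)); congr (_ *: _).
rewrite /pa_one (big_morph (pa_mul^~ _) (fun _ _ => pa_mulDl _ _ _) (pa_mul0x _)).
rewrite (bigD1 (pend p)) //= big1 ?addr0 => [|v ne].
  by rewrite pa_mulUU /pcomp_elt pcomp_vl eqxx.
by rewrite pa_mulUU /pcomp_elt pcomp_vl eq_sym (negbTE ne).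
Qed.

Lemma pa_mulx1 : right_id pa_one pa_mul.
Proof.
elim/pa_ind => [|x y hx hy|k p].
- by rewrite pa_mul0x.
- by rewrite pa_mulDl hx hy.
rewrite -(pa_scaleAl k (path_elt p) pa_one); congr (_ *: _).
rewrite /pa_one (big_morph (pa_mul _) (fun _ _ => pa_mulDr _ _ _) (pa_mulx0 _)).
rewrite (bigD1 (pstart p)) //= big1 ?addr0 => [|v ne].
  by rewrite pa_mulUU /pcomp_elt pcomp_vr eqxx.
by rewrite pa_mulUU /pcomp_elt pcomp_vr eq_sym (negbTE ne).
Qed.

HB.instance Definition _ := GRing.Zmodule_isPzRing.Build A
  pa_mulA pa_mul1x pa_mulx1 pa_mulDl pa_mulDr.

End PathAlgebra.

HB.mixin Record isTwoSidedIdeal (R : pzRingType) (S : R -> bool) := {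
  ideal_mull : forall a x, x \in S -> a * x \in S;
  ideal_mulr : forall a x, x \in S -> x * a \in S
}.

#[short(type="twosided")]
HB.structure Definition TwoSided (R : pzRingType) :=
  {S of GRing.ZmodClosed R S & isTwoSidedIdeal R S}.

Definition ideal_gen (R : pzRingType) (X : R -> Prop) (x : R) : Prop :=
  forall I : twosided R, (forall y, X y -> y \in I) -> x \in I.

Section RingQuotient.
Variables (R : pzRingType) (I : twosided R).

Definition rquot : Type := Quotient.quot I.
HB.instance Definition _ := GRing.Zmodule.on rquot.

Definition rpi (x : R) : rquot := \pi_(Quotient.quot I) x.

Definition rquot_one : rquot := rpi 1.
Definition rquot_mul (x y : rquot) : rquot :=
  rpi (repr (x : Quotient.quot I) * repr (y : Quotient.quot I)).

Lemma rpi_eq x y : (rpi x == rpi y) = (x - y \in I).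
Proof. by rewrite Quotient.idealrBE. Qed.

Lemma rpi_eq0 x : (rpi x == 0) = (x \in I).
Proof. by rewrite -[x in RHS]subr0 -rpi_eq /rpi pi_zeror. Qed.

Lemma rpiD : {morph rpi : x y / x + y}.
Proof. by move=> x y; rewrite /rpi raddfD. Qed.

Lemma rpiM x y : rquot_mul (rpi x) (rpi y) = rpi (x * y).
Proof.
apply/eqP; rewrite rpi_eq.
set x' := repr _; set y' := repr _.
have hx : x' - x \in I by rewrite -rpi_eq /rpi reprK.
have hy : y' - y \in I by rewrite -rpi_eq /rpi reprK.
have -> : x' * y' - x * y = x' * (y' - y) + (x' - x) * y.
  by rewrite mulrBr mulrBl addrA subrK.
by apply: rpredD; [apply: ideal_mull | apply: ideal_mulr].
Qed.

Lemma rpi_surj (x : rquot) : exists y, x = rpi y.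
Proof. by exists (repr (x : Quotient.quot I)); rewrite /rpi reprK. Qed.

Lemma rquot_mulA : associative rquot_mul.
Proof.
move=> x y z; have [a ->] := rpi_surj x; have [b ->] := rpi_surj y; have [c ->] := rpi_surj z.
by rewrite !rpiM mulrA.
Qed.
Lemma rquot_mul1x : left_id rquot_one rquot_mul.
Proof. by move=> x; have [a ->] := rpi_surj x; rewrite rpiM mul1r. Qed.
Lemma rquot_mulx1 : right_id rquot_one rquot_mul.
Proof. by move=> x; have [a ->] := rpi_surj x; rewrite rpiM mulr1. Qed.
Lemma rquot_mulDl : left_distributive rquot_mul +%R.
Proof.
move=> x y z; have [a ->] := rpi_surj x; have [b ->] := rpi_surj y; have [c ->] := rpi_surj z.
by rewrite -rpiD !rpiM -rpiD mulrDl.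
Qed.
Lemma rquot_mulDr : right_distributive rquot_mul +%R.
Proof.
move=> x y z; have [a ->] := rpi_surj x; have [b ->] := rpi_surj y; have [c ->] := rpi_surj z.
by rewrite -rpiD !rpiM -rpiD mulrDr.
Qed.

HB.instance Definition _ := GRing.Zmodule_isPzRing.Build rquot
  rquot_mulA rquot_mul1x rquot_mulx1 rquot_mulDl rquot_mulDr.

End RingQuotient.

Section Modules.
Variable R : pzRingType.

Record submodule (V : lmodType R) := Submodule {
  sub_pred :> {pred V};
  sub_closed : submod_closed sub_pred
}.
HB.instance Definition _ (V : lmodType R) (N : submodule V) :=
  GRing.isSubmodClosed.Build R V (sub_pred N) (sub_closed N).

Section SubQuotient.
Variable V : lmodType R.

Section Sub.
Variable N : submodule V.

Record submod_of : predArgType :=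
  SubmodOf { submod_val :> V; _ : submod_val \in N }.
HB.instance Definition _ := [isSub for submod_val].
HB.instance Definition _ := [Choice of submod_of by <:].
HB.instance Definition _ := [SubChoice_isSubZmodule of submod_of by <:].
HB.instance Definition _ := [SubZmodule_isSubLmodule of submod_of by <:].
End Sub.

Section Quot.
Variable N : submodule V.

Definition mquot : Type := Quotient.quot N.
HB.instance Definition _ := GRing.Zmodule.on mquot.

Definition mpi (x : V) : mquot := \pi_(Quotient.quot N) x.
Definition mquot_scale (a : R) (x : mquot) : mquot :=
  mpi (a *: repr (x : Quotient.quot N)).

Lemma mpi_eq x y : (mpi x == mpi y) = (x - y \in N).
Proof. by rewrite Quotient.idealrBE. Qed.

Lemma mpiD : {morph mpi : x y / x + y}.
Proof. by move=> x y; rewrite /mpi raddfD. Qed.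

Lemma mpiZ a x : mquot_scale a (mpi x) = mpi (a *: x).
Proof.
by apply/eqP; rewrite mpi_eq -scalerBr rpredZ // -mpi_eq /mpi reprK.
Qed.

Lemma mpi_surj (x : mquot) : exists y, x = mpi y.
Proof. by exists (repr (x : Quotient.quot N)); rewrite /mpi reprK. Qed.

Lemma mquot_scalerA a b x : mquot_scale a (mquot_scale b x) = mquot_scale (a * b) x.
Proof. by have [y ->] := mpi_surj x; rewrite !mpiZ scalerA. Qed.
Lemma mquot_scale1r : left_id 1 mquot_scale.
Proof. by move=> x; have [y ->] := mpi_surj x; rewrite mpiZ scale1r. Qed.
Lemma mquot_scalerDr : right_distributive mquot_scale +%R.
Proof.
move=> a x y; have [u ->] := mpi_surj x; have [v ->] := mpi_surj y.
by rewrite -mpiD !mpiZ -mpiD scalerDr.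
Qed.
Lemma mquot_scalerDl x : {morph mquot_scale^~ x : a b / a + b}.
Proof. by move=> a b; have [y ->] := mpi_surj x; rewrite !mpiZ -mpiD scalerDl. Qed.

HB.instance Definition _ := GRing.Zmodule_isLmodule.Build R mquot
  mquot_scalerA mquot_scale1r mquot_scalerDr mquot_scalerDl.
End Quot.

End SubQuotient.

(* M \cap N as a submodule of N. *)
Fact restrict_closed (V : lmodType R) (M N : submodule V) :
  submod_closed [pred x : submod_of N | \val x \in M].
Proof.
split=> [|a x y]; rewrite !inE; first by rewrite raddf0 rpred0.
by move=> hx hy; rewrite linearP; apply: rpredD => //; apply: rpredZ.
Qed.
Definition restrict (V : lmodType R) (M N : submodule V) : submodule (submod_of N) :=
  Submodule (restrict_closed M N).

(* The factor N / M, for submodules M of N of V. *)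
Definition subquot (V : lmodType R) (N M : submodule V) : lmodType R :=
  mquot (restrict M N).

Definition fin_gen (V : lmodType R) : Prop :=
  exists s : seq V, forall N : submodule V, {subset s <= N} -> forall x, x \in N.

Definition simple_module (V : lmodType R) : Prop :=
  (exists x : V, x != 0) /\
  forall N : submodule V,
    (forall x, x \in N -> x = 0) \/ (forall x, x \in N).

(* series_from M s: the list s = [:: M_1; ...; M_n] is such that
   M <= M_1 <= ... <= M_n = V, with all factors simple. *)
Fixpoint series_from (V : lmodType R) (M : submodule V)
    (s : seq (submodule V)) : Prop :=
  if s is N :: s' then
    [/\ {subset M <= N}, simple_module (subquot N M) & series_from N s']
  else forall x, x \in M.

Fact zero_sub_closed (V : lmodType R) : submod_closed (pred1 (0 : V)).
Proof.
split=> [|a x y]; rewrite !inE // => /eqP-> /eqP->.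
by rewrite scaler0 addr0.
Qed.
Definition zero_sub (V : lmodType R) : submodule V :=
  Submodule (zero_sub_closed V).

(* The composition series 0 = M_0 <= M_1 <= ... <= M_n = V is encoded by
   [:: M_1; ...; M_n], so that its length n is the size of the list. *)
Definition composition_series (V : lmodType R) (s : seq (submodule V)) : Prop :=
  series_from (zero_sub V) s.

Definition has_length (V : lmodType R) (n : nat) : Prop :=
  exists2 s : seq (submodule V), composition_series s & size s = n.

(* Submodules are compared as subsets of V. *)
Definition uniserial (V : lmodType R) : Prop :=
  exists2 s : seq (submodule V), composition_series s &
    forall s', composition_series s' ->
      map (@sub_pred V) s' = map (@sub_pred V) s.

Definition maximal_sub (V : lmodType R) (M : submodule V) : Prop :=
  (exists x, x \notin M) /\
  forall N : submodule V, {subset M <= N} ->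
    {subset N <= M} \/ (forall x, x \in N).

(* The intersection of the maximal left ideals. *)
Definition jacobson (a : R) : Prop :=
  forall M : submodule R^o, maximal_sub M -> (a : R^o) \in M.

(* JU, the submodule of U generated by the products j u, for j in J. *)
Fact rad_sub_closed (U : lmodType R) : submod_closed (fun x : U =>
  `[< forall N : submodule U,
        (forall j u, jacobson j -> j *: u \in N) -> x \in N >]).
Proof.
split=> [|a x y]; first by apply/asboolP => N _; apply: rpred0.
move=> /asboolP hx /asboolP hy; apply/asboolP => N h.
by apply: rpredD; [apply: rpredZ; apply: hx | apply: hy].
Qed.
Definition rad_sub (U : lmodType R) : submodule U := Submodule (rad_sub_closed U).

Definition rad_incl (U : lmodType R) : {linear submod_of (rad_sub U) -> U} :=
  \val.

Definition split_mono (M N : lmodType R) (f : {linear M -> N}) : Prop :=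
  exists r : {linear N -> M}, forall x, r (f x) = x.

Definition split_epi (M N : lmodType R) (f : {linear M -> N}) : Prop :=
  exists r : {linear N -> M}, forall y, f (r y) = y.

Definition irreducible_map (M N : lmodType R) (f : {linear M -> N}) : Prop :=
  [/\ ~ split_mono f, ~ split_epi f &
      forall (X : lmodType R) (h : {linear M -> X}) (g : {linear X -> N}),
        fin_gen X -> (forall x, f x = g (h x)) -> split_mono h \/ split_epi g].

End Modules.

Section BoundQuiver.
Variables (K : fieldType) (Gamma : quiver).
Local Notation KGamma := (path_algebra K Gamma).

(* The m-th power (m >= 1) of the ideal generated by the arrows, i.e. the ideal
   generated by the paths of length m. *)
Definition arrow_ideal_pow (m : nat) : KGamma -> Prop :=
  ideal_gen (fun x => exists2 p : qpath Gamma, plen p = m & x = path_elt K p).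

Definition admissible (I : twosided KGamma) : Prop :=
  (forall x, x \in I -> arrow_ideal_pow 2 x) /\
  exists2 m, (2 <= m)%N & forall x, arrow_ideal_pow m x -> x \in I.

Definition monomial (I : twosided KGamma) : Prop :=
  exists X : qpath Gamma -> Prop, forall x,
    x \in I <-> ideal_gen (fun y => exists2 p, X p & y = path_elt K p) x.

Section Classes.
Variable I : twosided KGamma.

Definition path_cls (p : qpath Gamma) : rquot I := rpi I (path_elt K p).
Definition arrow_cls (a : arrow Gamma) : rquot I := path_cls (apath a).

Definition mast (p : qpath Gamma) (U : lmodType (rquot I)) : Prop :=
  has_length U (plen p).+1 /\ exists x : U, path_cls p *: x != 0.

(* For p = alpha_(n-1) ... alpha_1, the product alpha_i ... alpha_j in Lambda,
   which is 1 if i < j. *)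
Definition alphas (p : qpath Gamma) (i j : nat) : rquot I :=
  \prod_(a <- rev (drop j.-1 (take i (parrows p)))) arrow_cls a.

End Classes.

Section Arrows.
Variable p : qpath Gamma.
Local Notation n := (size (pverts p)).

(* The number in {1, ..., n} naming a vertex passed by p. *)
Definition pos (v : vertex Gamma) : nat := (index v (pverts p)).+1.

(* {i, ..., j}, as a set of vertices passed by p. *)
Definition vrange (i j : nat) : seq (vertex Gamma) := drop i.-1 (take j (pverts p)).

Definition arrowsB : {set arrow Gamma} :=
  [set b | (src b \in vrange 1 n.-1) && (tgt b \notin vrange 1 n)].
Definition arrowsB' : {set arrow Gamma} := [set b | src b == pend p].
Definition arrowsC : {set arrow Gamma} :=
  [set c | (src c \notin vrange 1 n) && (tgt c \in vrange 2 n)].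
Definition arrowsD : {set arrow Gamma} :=
  [set d | [&& src d \in vrange 1 n, tgt d \in vrange 1 n & d \notin parrows p]].
End Arrows.

End BoundQuiver.

(* Main.v *)
Require Import Defs.
From HB Require Import structures.
From mathcomp Require Import all_boot all_algebra.
From mathcomp Require Import boolp finmap monalg.
From mathcomp Require Import classical_sets functions.
Set Implicit Arguments.
Unset Strict Implicit.
Unset Printing Implicit Defensive.
Import GRing.Theory.
Local Open Scope ring_scope.
(** Let [u0] be an element with [p u0 != 0] and let [u i] be the image of [u0]
    under the first [i] arrows of [p].  The quiver being acyclic, the [u i] live
    at distinct vertices, and by counting composition factors they form a basis
    of [U] over [K] ([chain_spans]).  Arrows act as zero on simple modules, hence
    lie in the Jacobson radical, so the radical of [U] is spanned by the [u i]
    with [i > 0], that is, it consists of the elements with no component at the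
    first vertex ([rad_subE]).  Conditions (a) and (b) say that an arrow [a] off
    [p] satisfies [a p_i = 0] whenever the initial segment [p_i] of [p] stops
    short of the end of [p] ([no_exit]), and [b q a = 0] whenever [b p != 0] and
    [q] is a proper final segment of [p] that starts where [a] ends
    ([no_entry]).

    These conditions suffice.  By [no_exit], the arrows off [p] annihilate [U].
    Factor the inclusion of the radical as [g h] through [X].  Suppose some [x]
    has [b p x = 0] for all arrows [b] starting at the end of [p], while [g x]
    has a component at the first vertex.  Then the annihilator of [u0] kills the
    component of [x] at that vertex ([chain_annihilator]), and sending [u0] to a
    multiple of this component splits [g].  Otherwise the coefficient of [u0] in
    [g x] depends linearly on the elements [b p x] alone, that is, it equals
    [psi (p x)] for a functional [psi] that vanishes on the common kernel of the
    arrows [b] with [b p != 0].  By [no_entry] the formula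
    [t x = sum_i psi (q_i x) u_i], with [q_i] the final segment of [p] from its
    [i]-th vertex, is a homomorphism from [X] to [U] ([map_of_functional]).  It
    agrees with [g] at the first vertex and kills the image of [h], because the
    arrows [b] kill [U].  Hence [g - t] is a retraction of [h].

    They are necessary.  For a module [Y] with elements [f], [f'] the inclusion
    factors through the submodule of [U * Y] generated by the radical, [(u0, f)]
    and [(0, f')]; irreducibility gives a retraction or a section, and either
    one is determined by few data ([irreducible_test]).  Take for [Y] the module
    of additive maps from the algebra to [K], and for [f], [f'] coefficients of
    nonzero paths, which exist because the algebra is monomial.  If
    [a p_i] is nonzero, its coefficient is killed by the next initial segment of
    [p] but not by [a p_i], which excludes a retraction and a section
    ([irreducible_no_exit]).  If [b q a] and [b p] are both nonzero, with
    coefficients [f'] and [f], and [p = q p_i], then [a f' = p_i f], which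
    excludes a retraction as [a] kills [U]; and [b p] kills [u0] but not [f],
    which excludes a section ([irreducible_no_entry]). *)

(** * Linear functionals, coinduced modules and maps of modules *)

(** A subspace containing [G] that is maximal among those avoiding [e] is a
    hyperplane complementary to the line of [e]; [psi] is the coordinate along
    [e].  The chains in Zorn's lemma may be empty, whence the [G x \/ A x]. *)
Lemma separating_functional (K : fieldType) (E : lmodType K) (G : E -> Prop) (e : E) :
    G 0 -> (forall k x y, G x -> G y -> G (k *: x + y)) -> ~ G e ->
  exists psi : E -> K, [/\ scalar psi, forall x, G x -> psi x = 0 & psi e = 1].
Proof.
move=> G0 GL Ge.
pose S (A : set E) x := G x \/ A x.
pose P : set (set E) := fun A =>
  ~ S A e /\ forall k x y, S A x -> S A y -> S A (k *: x + y).
have [F FP totF|W [[We WL] Wmax]] := @Zorn_bigcup E P.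
  split=> [[//|[A FA Ae]]|k x y].
    by have [+ _] := FP _ FA; apply; right.
  have bigS A z : F A -> S A z -> S (\bigcup_(X in F) X)%classic z.
    by move=> FA [?|?]; [left|right; exists A].
  case=> [Gx|[A FA Ax]] [Gy|[B FB By]].
  - by left; apply: GL.
  - by apply: (bigS B) => //; apply: (FP _ FB).2; [left|right].
  - by apply: (bigS A) => //; apply: (FP _ FA).2; [right|left].
  - case: (totF _ _ FA FB) => sub.
      by apply: (bigS B) => //; apply: (FP _ FB).2; right => //; apply: sub.
    by apply: (bigS A) => //; apply: (FP _ FA).2; right => //; apply: sub.
have W0 : S W 0 by left.
have WZ k x : S W x -> S W (k *: x) by move=> h; rewrite -[_ *: _]addr0; apply: WL.
have WB x y : S W x -> S W y -> S W (x - y).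
  by move=> hx hy; rewrite -scaleN1r addrC; apply: WL.
(* If [x] is outside [W], maximality puts [e] in the span of [W] and [x]. *)
have coordE x : exists c, S W (x - c *: e).
  have [Wx|nWx] := pselect (S W x); first by exists 0; rewrite scale0r subr0.
  pose W' : set E := fun y => exists k, S W (y - k *: x).
  have SW' y : S W' y -> W' y by case=> // Gy; exists 0; rewrite scale0r subr0; left.
  have W'L k y z : S W' y -> S W' z -> S W' (k *: y + z).
    move=> /SW'[a ha] /SW'[b hb]; right; exists (k * a + b).
    have -> : k *: y + z - (k * a + b) *: x = k *: (y - a *: x) + (z - b *: x).
      by rewrite scalerBr scalerA scalerDl opprD addrACA.
    exact: WL.
  have /SW'[k Wk] : S W' e.
    apply/not_notP => nW'e; apply: (Wmax W'); last by split.
    split=> [y Wy|sub]; first by exists 0; rewrite scale0r subr0; right.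
    apply: nWx; right; apply: sub; exists 1; rewrite scale1r subrr; exact: W0.
  have k0 : k != 0.
    by apply/eqP => k0; move: Wk; rewrite k0 scale0r subr0.
  exists k^-1.
  have -> : x - k^-1 *: e = (- k^-1) *: (e - k *: x).
    by rewrite scalerBr scalerA mulNr mulVf // !scaleNr scale1r opprK addrC.
  exact: WZ.
have [psi hpsi] := choice coordE.
have uniqc x c d : S W (x - c *: e) -> S W (x - d *: e) -> c = d.
  move=> hc hd; apply/eqP; rewrite -subr_eq0; apply/eqP/not_notP => /eqP ne.
  apply: We; have := WZ (c - d)^-1 _ (WB _ _ hd hc).
  have -> : x - d *: e - (x - c *: e) = (c - d) *: e.
    by rewrite opprB addrC addrA subrK scalerBl.
  by rewrite scalerA mulVf // scale1r.
exists psi; split.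
- move=> k x y; apply: (uniqc (k *: x + y)); first exact: hpsi.
  have -> : k *: x + y - (k * psi x + psi y) *: e =
     k *: (x - psi x *: e) + (y - psi y *: e).
    by rewrite scalerBr scalerA scalerDl opprD addrACA.
  exact: WL.
- by move=> x Gx; apply: (uniqc x) => //; rewrite scale0r subr0; left.
- by apply: (uniqc e) => //; rewrite scale1r subrr.
Qed.

(** Separates the vector [(0, 1)] from the graph of [f] over [T]. *)
Lemma functional_factor (K : fieldType) (V Z : lmodType K) (T : {linear V -> Z})
    (f : V -> K) :
    scalar f -> (forall x, T x = 0 -> f x = 0) ->
  exists2 phi : Z -> K, scalar phi & forall x, f x = phi (T x).
Proof.
move=> fL ker.
pose E : lmodType K := (Z * K^o)%type.
pose G (z : E) := exists x, z = (T x, f x).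
have f0 : f 0 = 0 by apply: ker; rewrite linear0.
have [||[x [/esym /ker -> /eqP]]|psi [psiL psiG psi1]] := @separating_functional K E G (0, 1).
- by exists 0; rewrite linear0 f0.
- by move=> k _ _ [x ->] [y ->]; exists (k *: x + y); rewrite linearP fL.
- by rewrite oner_eq0.
have psi0 : psi 0 = 0 by apply: psiG; exists 0; rewrite linear0 f0.
have psiP z c : psi (z, c) = psi (z, 0) + c.
  have -> : (z, c) = c *: ((0, 1) : E) + (z, 0) :> E.
    by congr pair; rewrite /= ?scaler0 ?add0r ?addr0 // /GRing.scale /= mulr1.
  by rewrite psiL psi1 mulr1 addrC.
exists (fun z => - psi (z, 0)) => [k x y|x].
  have -> : (k *: x + y, 0) = k *: ((x, 0) : E) + (y, 0) :> E.
    by congr pair; rewrite /= scaler0 addr0.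
  by rewrite psiL opprD mulrN.
have : psi (T x, f x) = 0 by apply: psiG; exists x.
by rewrite psiP => /eqP; rewrite addrC addr_eq0 => /eqP.
Qed.

Section Maps.
Variables (R : pzRingType) (U V : lmodType R).

Lemma linear_map (f : U -> V) : linear f -> exists F : {linear U -> V}, F =1 f.
Proof.
move=> fL; pose L := GRing.isLinear.Build R U V *:%R f fL.
by exists (HB.pack_for {linear U -> V} f L).
Qed.


Lemma cyclic_map (u : U) (v : V) :
    (forall x, exists r, x = r *: u) -> (forall r, r *: u = 0 -> r *: v = 0) ->
  exists F : {linear U -> V}, forall r, F (r *: u) = r *: v.
Proof.
move=> gen ann; have [c cE] := choice gen.
have wd r s : r *: u = s *: u -> r *: v = s *: v.
  move=> /eqP; rewrite -subr_eq0 -scalerBl => /eqP /ann /eqP.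
  by rewrite scalerBl subr_eq0 => /eqP.
have [|F FE] := @linear_map (fun x => c x *: v).
  move=> r x y /=; rewrite scalerA -scalerDl; apply: wd.
  by rewrite scalerDl -scalerA -!cE.
by exists F => r; rewrite FE; apply: wd; rewrite -cE.
Qed.
End Maps.

Lemma corestrict_map (R : pzRingType) (U V : lmodType R) (N : submodule V) (f : {linear U -> V}) :
  (forall x, f x \in N) ->
  exists F : {linear U -> submod_of N}, forall x, \val (F x) = f x.
Proof.
move=> fN; have [|F FE] := @linear_map R U (submod_of N) (fun x => SubmodOf (fN x)).
  by move=> a x y; apply: val_inj; rewrite [RHS]linearP /=; apply: linearP.
by exists F => x; rewrite FE.
Qed.

Section Coinduced.
Variables (R : pzRingType) (A : zmodType).

Definition additive_map : {pred R -> A} :=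
  fun f => `[< {morph f : x y / x + y} >].

Fact additive_map_closed : zmod_closed additive_map.
Proof.
split=> [|f g /asboolP fD /asboolP gD]; apply/asboolP => x y /=.
  by rewrite addr0.
by rewrite !fctE fD gD opprD addrACA.
Qed.
HB.instance Definition _ :=
  GRing.isZmodClosed.Build (R -> A) additive_map additive_map_closed.

(** The left module of additive maps from [R] to [A], on which [r] acts by
    precomposition with right multiplication by [r]. *)
Record coind : predArgType :=
  Coind { coind_val :> R -> A; _ : coind_val \in additive_map }.
HB.instance Definition _ := [isSub for coind_val].
HB.instance Definition _ := [Choice of coind by <:].
HB.instance Definition _ := [SubChoice_isSubZmodule of coind by <:].

Lemma coindD (f : coind) : {morph f : x y / x + y}.
Proof. by case: f => f /= /asboolP. Qed.

Fact coind_scale_subproof (r : R) (f : coind) : (fun s => f (s * r)) \in additive_map.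
Proof. by apply/asboolP => x y; rewrite mulrDl coindD. Qed.
Definition coind_scale r f := Coind (coind_scale_subproof r f).

Fact coind_scaleA r s f : coind_scale r (coind_scale s f) = coind_scale (r * s) f.
Proof. by apply/val_inj/funext => x /=; rewrite mulrA. Qed.
Fact coind_scale1 : left_id 1 coind_scale.
Proof. by move=> f; apply/val_inj/funext => x /=; rewrite mulr1. Qed.
Fact coind_scaleDr : right_distributive coind_scale +%R.
Proof. by move=> r f g; apply/val_inj/funext. Qed.
Fact coind_scaleDl f : {morph coind_scale^~ f : r s / r + s}.
Proof. by move=> r s; apply/val_inj/funext => x /=; rewrite mulrDr coindD. Qed.
HB.instance Definition _ := GRing.Zmodule_isLmodule.Build R coind
  coind_scaleA coind_scale1 coind_scaleDr coind_scaleDl.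

Lemma coindZE (r : R) (f : coind) s : (r *: f) s = f (s * r).
Proof. by []. Qed.
Lemma coindDE (f g : coind) s : (f + g) s = f s + g s.
Proof. by []. Qed.
End Coinduced.

(** * Paths in an acyclic quiver *)

Section Subpaths.
Variable Gamma : quiver.
Implicit Types (p q : qpath Gamma) (a : arrow Gamma).

(** Vertices are counted from 0, so that [ptake i p] ends at [pvert p i]. *)
Definition pvert p i := nth (pstart p) (pverts p) i.

Lemma pverts_size p : size (pverts p) = (plen p).+1.
Proof. by rewrite /= size_map. Qed.

Fact ptake_walk i p : is_walk (pstart p) (take i (parrows p)).
Proof.
have := valP p; rewrite -/(pstart p) -/(parrows p) -{1}(cat_take_drop i (parrows p)).
by rewrite is_walk_cat => /andP[].
Qed.
Definition ptake i p : qpath Gamma :=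
  @QPath Gamma (pstart p, take i (parrows p)) (ptake_walk i p).

Fact pdrop_walk i p : is_walk (pend (ptake i p)) (drop i (parrows p)).
Proof.
have := valP p; rewrite -/(pstart p) -/(parrows p) -{1}(cat_take_drop i (parrows p)).
by rewrite is_walk_cat => /andP[].
Qed.
Definition pdrop i p : qpath Gamma :=
  @QPath Gamma (pend (ptake i p), drop i (parrows p)) (pdrop_walk i p).

Lemma ptake0 p : ptake 0 p = vpath (pstart p).
Proof. by apply: qpath_eq; rewrite // /ptake /parrows /= take0. Qed.

Lemma ptake_plen p : ptake (plen p) p = p.
Proof. by apply: qpath_eq; rewrite // /ptake /parrows /= take_size. Qed.

Lemma pend_pdrop i p : pend (pdrop i p) = pend p.
Proof.
rewrite /pend /pdrop /pstart /parrows /= -last_cat -map_cat.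
by rewrite -/(parrows p) cat_take_drop.
Qed.

Lemma pvert0 p : pvert p 0 = pstart p. Proof. by []. Qed.

Lemma pend_ptake i p : (i <= plen p)%N -> pend (ptake i p) = pvert p i.
Proof.
move=> le_i; rewrite /pend (last_nth (pstart p)) size_map /parrows /= size_takel //.
by rewrite /pvert /pverts map_take; case: i le_i => //= i le_i; rewrite nth_take.
Qed.

Lemma pstart_pdrop i p : (i <= plen p)%N -> pstart (pdrop i p) = pvert p i.
Proof. exact: pend_ptake. Qed.

Lemma pdrop0 p : pdrop 0 p = p.
Proof.
apply: qpath_eq; first by rewrite pstart_pdrop.
by rewrite /pdrop {1}/parrows /= drop0.
Qed.

Lemma pvert_plen p : pvert p (plen p) = pend p.
Proof. by rewrite -pend_ptake // ptake_plen. Qed.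

Lemma mem_pvert p i : (i <= plen p)%N -> pvert p i \in pverts p.
Proof. by move=> le_i; rewrite mem_nth // pverts_size. Qed.

Lemma pvertP p v :
  reflect (exists2 i, (i <= plen p)%N & pvert p i = v) (v \in pverts p).
Proof.
apply: (iffP (nthP (pstart p))) => -[i].
  by rewrite pverts_size ltnS; exists i.
by move=> le_i <-; exists i; rewrite // pverts_size.
Qed.

Lemma parrow_ends p a : a \in parrows p ->
  src a = pvert p (index a (parrows p)) /\ tgt a = pvert p (index a (parrows p)).+1.
Proof.
move=> ap; have lt_i : (index a (parrows p) < plen p)%N by rewrite index_mem.
set i := index _ _ in lt_i *.
split; last by rewrite /pvert /= (nth_map a) // nth_index.
have := pdrop_walk i p; rewrite (drop_nth a) // nth_index //= => /andP[/eqP-> _].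
by rewrite pend_ptake // ltnW.
Qed.

Lemma parrow_at p i : (i < plen p)%N ->
  exists2 a, a \in parrows p & pvert p i = src a /\ pvert p i.+1 = tgt a.
Proof.
move=> lt_i; have [a _] : exists a, a \in parrows p.
  move: lt_i; rewrite /plen.
  by case: (parrows p) => // a s _; exists a; rewrite mem_head.
pose b := nth a (parrows p) i; exists b; first exact: mem_nth.
split; last by rewrite /pvert /= (nth_map a).
have := pdrop_walk i p; rewrite (drop_nth a) //= => /andP[/eqP-> _].
by rewrite pend_ptake // ltnW.
Qed.

Hypothesis acyclic : triangular Gamma.

(** Otherwise [q] followed by [a] would be a directed cycle. *)
Lemma no_return a q : pstart q = tgt a -> pend q <> src a.
Proof.
move=> sq eq; case: (pcompP q (apath a)) => [r _ sr er ar|]; last by rewrite sq eqxx.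
have := acyclic (p := r); rewrite sr er /plen ar eq => /(_ erefl).
by rewrite size_cat.
Qed.

(** Two passages through the same vertex would enclose a directed cycle. *)
Lemma pverts_uniq p : uniq (pverts p).
Proof.
apply/negPn/negP => /(uniqPn (pstart p))[i [j []]].
rewrite pverts_size ltnS -!/(pvert p _) => lt_ij le_j e.
have lei : (i <= plen (ptake j p))%N by rewrite /plen /parrows /= size_takel // ltnW.
have := acyclic (p := pdrop i (ptake j p)).
rewrite pend_pdrop pstart_pdrop // pend_ptake //.
have -> : pvert (ptake j p) i = pvert p i.
  rewrite /pvert /pverts map_take; case: (i) lt_ij => //= k lt_kj.
  by rewrite nth_take // ltnW.
move=> /(_ e) /eqP; rewrite /plen /parrows /= size_drop size_takel //.
by rewrite subn_eq0 leqNgt lt_ij.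
Qed.

Lemma pvert_inj p i j : (i <= plen p)%N -> (j <= plen p)%N ->
  pvert p i = pvert p j -> i = j.
Proof.
by move=> hi hj /eqP; rewrite /pvert nth_uniq ?pverts_size ?pverts_uniq // => /eqP.
Qed.

Lemma parrow_index p a i : a \in parrows p -> (i <= plen p)%N ->
  src a = pvert p i -> index a (parrows p) = i.
Proof.
move=> ap le_i; have [-> _] := parrow_ends ap; apply: pvert_inj => //.
by apply: ltnW; rewrite index_mem.
Qed.

Lemma plen_bound p : (plen p < #|vertex Gamma|)%N.
Proof. by rewrite -pverts_size -(card_uniqP (pverts_uniq p)) max_card. Qed.

Lemma index_pvert p i : (i <= plen p)%N -> index (pvert p i) (pverts p) = i.
Proof. by move=> le_i; rewrite index_uniq ?pverts_uniq // pverts_size. Qed.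

(** Otherwise [a] would close a segment of [p] to a directed cycle. *)
Lemma arrow_up p a i j : (i <= plen p)%N -> (j <= plen p)%N ->
  src a = pvert p i -> tgt a = pvert p j -> (i < j)%N.
Proof.
move=> le_i le_j sa ta; rewrite ltnNge; apply/negP => le_ji.
have lej : (j <= plen (ptake i p))%N by rewrite /plen /parrows /= size_takel.
apply: (@no_return a (pdrop j (ptake i p))); last by rewrite pend_pdrop pend_ptake.
rewrite pstart_pdrop // ta /pvert /pverts map_take.
by case: (j) le_ji => //= k lt_ki; rewrite nth_take.
Qed.

End Subpaths.

(** * Rings with a multiplicative basis of paths *)

(** Monomial algebras in the abstract: the classes of paths span the ring over a
    central field, multiply by composition, and those that are nonzero are
    linearly independent.  Spanning is phrased as an induction principle, and
    independence as the existence of coefficient functionals. *)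
Record monomial_ring (K : fieldType) (Gamma : quiver) := MonomialRing {
  mring :> pzRingType;
  base : {rmorphism K -> mring};
  cls : qpath Gamma -> mring;
  baseC : forall k (x : mring), base k * x = x * base k;
  cls_comp : forall q p r, pend p = pstart q -> pstart r = pstart p ->
    parrows r = parrows p ++ parrows q -> cls q * cls p = cls r;
  cls_comp0 : forall q p, pend p != pstart q -> cls q * cls p = 0;
  sum_e : \sum_v cls (vpath v) = 1;
  path_span : forall Q : mring -> Prop,
    Q 0 -> (forall x y, Q x -> Q y -> Q (x + y)) ->
    (forall k p, Q (base k * cls p)) -> forall x, Q x;
  path_coef : forall q, cls q != 0 -> exists f : mring -> K,
    {morph f : x y / x + y} /\
    forall k r, f (base k * cls r) = if r == q then k else 0
}.
Arguments base {K Gamma m}.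
Arguments cls {K Gamma m} p.
Arguments baseC {K Gamma m} k x.
Arguments cls_comp {K Gamma m} q p r _ _ _.
Arguments cls_comp0 {K Gamma m} q p _.

Section MonomialRings.
Variables (K : fieldType) (Gamma : quiver) (L : monomial_ring K Gamma).
Local Notation cls := (@cls K Gamma L).
Local Notation base := (@base K Gamma L).
Local Notation e_ v := (cls (vpath v)).
Local Notation ar a := (cls (apath a)).
Implicit Types (p q r : qpath Gamma) (a : arrow Gamma) (v : vertex Gamma).

Lemma e_cls v p : e_ v * cls p = if pend p == v then cls p else 0.
Proof.
case: (eqVneq (pend p) v) => e; last exact: cls_comp0.
by apply: cls_comp; rewrite ?cats0.
Qed.

Lemma cls_e v p : cls p * e_ v = if pstart p == v then cls p else 0.
Proof.
case: (eqVneq (pstart p) v) => e; last by apply: cls_comp0; rewrite eq_sym.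
by apply: cls_comp.
Qed.

Lemma e_cls_pend p : e_ (pend p) * cls p = cls p.
Proof. by rewrite e_cls eqxx. Qed.

Lemma cls_e_pstart p : cls p * e_ (pstart p) = cls p.
Proof. by rewrite cls_e eqxx. Qed.

Lemma e_e v w : e_ v * e_ w = if w == v then e_ w else 0.
Proof. exact: (e_cls v (vpath w)). Qed.

Lemma e_ar v a : e_ v * ar a = if tgt a == v then ar a else 0.
Proof. exact: e_cls. Qed.

Lemma ar_e v a : ar a * e_ v = if src a == v then ar a else 0.
Proof. exact: cls_e. Qed.

Lemma cls_rcons p a q : parrows q = rcons (parrows p) a -> pstart q = pstart p ->
  pend p = src a -> cls q = ar a * cls p.
Proof. by move=> aq sq ep; apply/esym/cls_comp; rewrite // aq cats1. Qed.

Lemma path_split p : plen p != 0%N ->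
  exists a q, [/\ parrows p = rcons (parrows q) a, pstart p = pstart q,
     pend q = src a & pend p = tgt a].
Proof.
rewrite /plen; case E : (parrows p) / (lastP (parrows p)) => [//|s a] _.
have tk : parrows (ptake (size s) p) = s.
  by rewrite /ptake {1}/parrows /= E -cats1 take_size_cat.
exists a, (ptake (size s) p); rewrite tk; split=> //.
  have := valP p; rewrite -/(pstart p) -/(parrows p) E -cats1 is_walk_cat /= andbT.
  by rewrite /pend tk => /andP[_ /eqP->].
by rewrite /pend E map_rcons last_rcons.
Qed.

Lemma plen0 p : plen p = 0%N -> p = vpath (pstart p).
Proof. by move/eqP/nilP => h; apply: qpath_eq. Qed.

Lemma path_ind (Q : qpath Gamma -> Prop) : (forall v, Q (vpath v)) ->
  (forall a p q, parrows q = rcons (parrows p) a -> pstart q = pstart p ->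
     pend p = src a -> pend q = tgt a -> Q p -> Q q) -> forall p, Q p.
Proof.
move=> Qv Qa p; move e : (plen p) => n; elim: n p e => [|n IHn] p e.
  by rewrite (plen0 e).
have [|a [q [ap sp eq tp]]] := @path_split p; first by rewrite e.
apply: (Qa a q p) => //; apply: IHn.
by move: e; rewrite /plen ap size_rcons => -[].
Qed.

Lemma gen_ind (Q : L -> Prop) :
  (forall x y, Q x -> Q y -> Q (x + y)) -> (forall x y, Q x -> Q y -> Q (x * y)) ->
  (forall k, Q (base k)) -> (forall v, Q (e_ v)) -> (forall a, Q (ar a)) ->
  forall x, Q x.
Proof.
move=> QD QM Qk Qv Qa; elim/path_span => [|x y|k p]; [|exact: QD|].
  by rewrite -(rmorph0 base).
apply: (QM) => //; elim/path_ind: p => // a p q aq sq ep _ Qp.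
by rewrite (cls_rcons aq sq ep); apply: QM.
Qed.

Lemma cls_prodr q : (\prod_(a <- rev (parrows q)) ar a) * e_ (pstart q) = cls q.
Proof.
elim/path_ind: q => [v|a p q aq sq ep _ IHp]; first by rewrite big_nil mul1r.
by rewrite aq rev_rcons big_cons -mulrA sq IHp -(cls_rcons aq sq ep).
Qed.

Lemma cls_prodl q : e_ (pend q) * \prod_(a <- rev (parrows q)) ar a = cls q.
Proof.
elim/path_ind: q => [v|a p q aq sq ep eq IHp]; first by rewrite big_nil mulr1.
rewrite aq rev_rcons big_cons mulrA e_ar eq eqxx (cls_rcons aq sq ep) -IHp mulrA.
by rewrite ar_e ep eqxx.
Qed.

Section Modules.
Variables (M : lmodType L).
Implicit Types x y : M.

(** Restriction of scalars along [base]. *)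
Definition base_mod : Type := M.
HB.instance Definition _ := GRing.Zmodule.on base_mod.
Definition base_scale (k : K) (x : base_mod) : base_mod := base k *: (x : M).
Fact base_scaleA k l x : base_scale k (base_scale l x) = base_scale (k * l) x.
Proof. by rewrite /base_scale scalerA -(rmorphM base). Qed.
Fact base_scale1 : left_id 1 base_scale.
Proof. by move=> x; rewrite /base_scale rmorph1 scale1r. Qed.
Fact base_scaleDr : right_distributive base_scale +%R.
Proof. by move=> k x y; rewrite /base_scale scalerDr. Qed.
Fact base_scaleDl x : {morph base_scale^~ x : k l / k + l}.
Proof. by move=> k l; rewrite /base_scale rmorphD scalerDl. Qed.
HB.instance Definition _ := GRing.Zmodule_isLmodule.Build K base_mod
  base_scaleA base_scale1 base_scaleDr base_scaleDl.

Lemma sum_e_scale x : \sum_v e_ v *: x = x.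
Proof. by rewrite -scaler_suml sum_e scale1r. Qed.

Lemma baseZC k (a : L) x : a *: (base k *: x) = base k *: (a *: x).
Proof. by rewrite !scalerA baseC. Qed.

Lemma base_eq0 k x : base k *: x = 0 -> k = 0 \/ x = 0.
Proof.
move=> h; case: (eqVneq k 0) => k0; [by left|right].
by rewrite -[x]scale1r -(rmorph1 base) -(mulVf k0) (rmorphM base) -scalerA h scaler0.
Qed.

End Modules.

(** The ring is generated by the scalars, the vertices and the arrows. *)
Lemma linear_on_gens (M N : lmodType L) (f : M -> N) :
  {morph f : x y / x + y} ->
  (forall k x, f (base k *: x) = base k *: f x) ->
  (forall v x, f (e_ v *: x) = e_ v *: f x) ->
  (forall a x, f (ar a *: x) = ar a *: f x) -> linear f.
Proof.
move=> fD fk fv fa r x y; rewrite fD; congr (_ + _); move: x.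
elim/gen_ind: r => // [r s hr hs x|r s hr hs x].
  by rewrite !scalerDl fD hr hs.
by rewrite -!scalerA hr hs.
Qed.

(** * Acyclic quivers: loops and simple modules *)

Hypothesis acyclic : triangular Gamma.

(** The only path from [v] to [v] in an acyclic quiver is the trivial one. *)
Lemma e_loop v (x : L) : exists k, e_ v * x * e_ v = base k * e_ v.
Proof.
elim/path_span: x => [|x y [k hk] [l hl]|k p].
- by exists 0; rewrite mulr0 mul0r rmorph0 mul0r.
- by exists (k + l); rewrite mulrDr mulrDl hk hl rmorphD mulrDl.
rewrite mulrA -baseC -!mulrA cls_e.
case: (eqVneq (pstart p) v) => [sp|_]; last first.
  by exists 0; rewrite !mulr0 rmorph0 mul0r.
rewrite e_cls; case: (eqVneq (pend p) v) => [ep|_]; last first.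
  by exists 0; rewrite !mulr0 rmorph0 mul0r.
by exists k; rewrite [p]plen0 ?sp //; apply: acyclic; rewrite sp ep.
Qed.

(** A longest path that does not annihilate the module produces an element
    annihilated by all arrows; its multiples form a submodule, hence everything. *)
Lemma simple_line (S : lmodType L) : simple_module S ->
  (exists y : S, forall x, exists k, x = base k *: y) /\
  (forall a (x : S), ar a *: x = 0).
Proof.
move=> [[x0 x0n0] simp].
have [p [x [pxn0 pmax]]] : exists p (x : S), cls p *: x != 0 /\
    forall q, (plen p < plen q)%N -> forall y : S, cls q *: y = 0.
  pose Q n := `[< exists2 p, plen p = n & exists x : S, cls p *: x != 0 >].
  have exQ : exists n, Q n.
    have [v hv] : exists v, e_ v *: x0 != 0.
      apply: contrapT => h; move/eqP: x0n0; apply; rewrite -(sum_e_scale x0).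
      apply: big1 => v _; apply/eqP/negPn/negP => nv; apply: h; by exists v.
    by exists 0%N; apply/asboolP; exists (vpath v) => //; exists x0.
  have ubQ n : Q n -> (n <= #|vertex Gamma|)%N.
    by move=> /asboolP[p <- _]; apply/ltnW/plen_bound.
  case: (ex_maxnP exQ ubQ) => n /asboolP[p lp [x px]] max.
  exists p, x; split=> // q lt y; apply/eqP/negPn/negP => qy.
  have : (plen q <= n)%N by apply: max; apply/asboolP; exists q => //; exists y.
  by rewrite leqNgt -lp lt.
pose y := cls p *: x.
have ay a : ar a *: y = 0.
  rewrite /y scalerA; case: (eqVneq (pend p) (src a)) => e; last first.
    by rewrite cls_comp0 // scale0r.
  case: (pcompP (apath a) p) => [q _ sq _ aq|]; last by rewrite e eqxx.
  rewrite (cls_comp (apath a) p q) // pmax // /plen aq size_cat /= addn1 //.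
have ey v : exists k, e_ v *: y = base k *: y.
  rewrite /y scalerA e_cls; case: eqP => _; first by exists 1; rewrite rmorph1 scale1r.
  by exists 0; rewrite rmorph0 !scale0r.
have closedL : submod_closed (fun z : S => `[< exists k, z = base k *: y >]).
  have LD z t : (exists k, z = base k *: y) -> (exists k, t = base k *: y) ->
      exists k, z + t = base k *: y.
    by move=> [k ->] [l ->]; exists (k + l); rewrite rmorphD scalerDl.
  split=> [|r z t /asboolP hz /asboolP ht]; apply/asboolP.
    by exists 0; rewrite rmorph0 scale0r.
  apply: (LD) => //; elim/gen_ind: r z hz {t ht} => [r s hr hs z hz|r s hr hs z hz|k z|v z|a z].
  - by rewrite scalerDl; apply: (LD); [apply: hr|apply: hs].
  - by rewrite -scalerA; apply: hr; apply: hs.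
  - by case=> l ->; exists (k * l); rewrite rmorphM scalerA.
  - case=> l ->; rewrite baseZC; have [m ->] := ey v.
    by exists (l * m); rewrite rmorphM scalerA.
  - by case=> l ->; rewrite baseZC ay; exists 0; rewrite rmorph0 scale0r scaler0.
have [L0|LT] := simp (Submodule closedL).
  move/eqP: pxn0; case; apply: L0; apply/asboolP; exists 1.
  by rewrite rmorph1 scale1r.
have gen z : exists k, z = base k *: y by apply/asboolP; exact: LT.
split=> [|a z]; first by exists y.
by have [k ->] := gen z; rewrite baseZC ay scaler0.
Qed.

End MonomialRings.

(** * Arrows in the radical, and coefficients of paths *)

Section MaximalSubmodules.
Variables (R : pzRingType) (V : lmodType R) (M : submodule V).

Lemma mpi_eq0 x : (Defs.mpi M x == 0) = (x \in M).
Proof.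
have -> : 0 = Defs.mpi M 0 by rewrite /Defs.mpi raddf0.
by rewrite mpi_eq subr0.
Qed.

Lemma mpi_scale r x : r *: Defs.mpi M x = Defs.mpi M (r *: x).
Proof. exact: mpiZ. Qed.

Lemma maximal_simple : maximal_sub M -> simple_module (mquot M).
Proof.
move=> [[x xM] max]; split; first by exists (Defs.mpi M x); rewrite mpi_eq0.
move=> N; have closedN : submod_closed (fun z : V => Defs.mpi M z \in N).
  split=> [|r y z yN zN].
    by rewrite /in_mem /= /Defs.mpi raddf0; apply: rpred0.
  by rewrite /in_mem /= mpiD -mpi_scale; apply: rpredD => //; apply: rpredZ.
have [y yM|NM|NT] := max (Submodule closedN).
- suff : Defs.mpi M y \in N by [].
  by move: yM; rewrite -mpi_eq0 => /eqP->; apply: rpred0.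
- left=> z; have [y ->] := mpi_surj z => yN; apply/eqP; rewrite mpi_eq0.
  exact: (NM y).
- by right=> z; have [y ->] := mpi_surj z; apply: (NT y).
Qed.

End MaximalSubmodules.

Section Coefficients.
Variables (K : fieldType) (Gamma : quiver) (L : monomial_ring K Gamma).
Local Notation cls := (@cls K Gamma L).
Local Notation base := (@base K Gamma L).
Local Notation ar a := (cls (apath a)).
Implicit Types (p q r : qpath Gamma) (f : coind L K).

(** An arrow annihilates the simple quotient of the ring by a maximal left ideal. *)
Lemma arrow_jacobson a : triangular Gamma -> jacobson (ar a).
Proof.
move=> acyclic M /maximal_simple /(simple_line acyclic)[_ /(_ a (Defs.mpi M 1))].
by rewrite mpi_scale => /eqP; rewrite mpi_eq0 /GRing.scale /= mulr1.
Qed.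

Definition coefficient q f :=
  forall k r, f (base k * cls r) = if r == q then k else 0.

Lemma coefficient_exists q : cls q != 0 -> exists f, coefficient q f.
Proof.
move=> /path_coef[f [fD fE]].
have fA : f \in @additive_map L K by apply/asboolP.
by exists (Coind fA).
Qed.

Lemma coind_at0 f : f 0 = 0.
Proof. by apply: (addrI (f 0)); rewrite -coindD !addr0. Qed.

Lemma coefficient_cls q f r : coefficient q f -> f (cls r) = if r == q then 1 else 0.
Proof. by move=> fq; rewrite -fq rmorph1 mul1r. Qed.

(** If [q] is [r] followed by [q'], the coefficient of [q] in [x r] is that of
    [q'] in [x]. *)
Lemma coefficient_mulr q f q' f' r x : coefficient q f -> coefficient q' f' ->
  pstart q = pstart r -> pend r = pstart q' -> parrows q = parrows r ++ parrows q' ->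
  f (x * cls r) = f' x.
Proof.
move=> fq fq' sq er aq; elim/path_span: x => [|x y hx hy|k s].
- by rewrite mul0r !coind_at0.
- by rewrite mulrDl !coindD hx hy.
rewrite fq' -mulrA; case: (pcompP s r) => [t e st _ at_|ne]; last first.
  rewrite cls_comp0 // mulr0 coind_at0; case: eqP => // es.
  by rewrite es er eqxx in ne.
rewrite (cls_comp s r t) // fq; congr (if _ then _ else _).
apply/eqP/eqP => [tq|sq'].
  apply: qpath_eq; first by rewrite -e.
  by move: at_; rewrite tq aq => /eqP; rewrite eqseq_cat // => /andP[_ /eqP].
by apply: qpath_eq; rewrite ?st ?sq // at_ aq sq'.
Qed.

Lemma coefficient_mulr0 q f r x : coefficient q f ->
  (forall s, parrows q <> parrows r ++ s) -> f (x * cls r) = 0.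
Proof.
move=> fq ne; elim/path_span: x => [|x y hx hy|k s].
- by rewrite mul0r coind_at0.
- by rewrite mulrDl coindD hx hy addr0.
rewrite -mulrA; case: (pcompP s r) => [t e st _ at_|nc]; last first.
  by rewrite cls_comp0 // mulr0 coind_at0.
rewrite (cls_comp s r t) // fq; case: eqP => // tq.
by case: (ne (parrows s)); rewrite -tq.
Qed.

Lemma coefficient_mull0 q f r x : coefficient q f ->
  (forall s, parrows q <> s ++ parrows r) -> f (cls r * x) = 0.
Proof.
move=> fq ne; elim/path_span: x => [|x y hx hy|k s].
- by rewrite mulr0 coind_at0.
- by rewrite mulrDr coindD hx hy addr0.
rewrite mulrA -baseC -mulrA; case: (pcompP r s) => [t e st _ at_|nc]; last first.
  by rewrite cls_comp0 // mulr0 coind_at0.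
rewrite (cls_comp r s t) // fq; case: eqP => // tq.
by case: (ne (parrows s)); rewrite -tq.
Qed.

Lemma coefficient_start q f : coefficient q f -> cls (vpath (pstart q)) *: f = f.
Proof.
by move=> fq; apply/val_inj/funext => x; apply: (coefficient_mulr _ fq fq).
Qed.

End Coefficients.

(** * The structure of a module with a mast *)

Section Chain.
Variables (K : fieldType) (Gamma : quiver) (L : monomial_ring K Gamma).
Local Notation cls := (@cls K Gamma L).
Local Notation base := (@base K Gamma L).
Local Notation e_ v := (cls (vpath v)).
Local Notation ar a := (cls (apath a)).
Hypothesis acyclic : triangular Gamma.

Lemma cls_drop_take p i : cls (pdrop i p) * cls (ptake i p) = cls p.
Proof. by apply: cls_comp => //; rewrite cat_take_drop. Qed.

Lemma ar_ptake p i a : (i < plen p)%N -> a \in parrows p -> src a = pvert p i ->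
  ar a * cls (ptake i p) = cls (ptake i.+1 p).
Proof.
move=> lt_i ap sa; have ei := parrow_index acyclic ap (ltnW lt_i) sa.
apply: cls_comp => //; first by rewrite pend_ptake ?sa // ltnW.
by rewrite /ptake /parrows /= (take_nth a) // -cats1 -ei nth_index.
Qed.

Lemma pdrop_ar p i a : (i < plen p)%N -> a \in parrows p -> src a = pvert p i ->
  cls (pdrop i.+1 p) * ar a = cls (pdrop i p).
Proof.
move=> lt_i ap sa; have [_ ta] := parrow_ends ap.
have ei := parrow_index acyclic ap (ltnW lt_i) sa.
apply: cls_comp; first by rewrite pstart_pdrop // -ei.
  by rewrite pstart_pdrop ?sa // ltnW.
by rewrite /pdrop /parrows /= (drop_nth a) // -ei nth_index.
Qed.

(** Each simple factor of the series contributes one dimension over [K]. *)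
Lemma series_span (U : lmodType L) (M : submodule U) (s : seq (submodule U)) :
  series_from M s -> exists y : nat -> U, forall x, exists c : nat -> K,
    x - \sum_(i < size s) base (c i) *: y i \in M.
Proof.
elim: s M => [|N s IHs] M /=.
  by move=> MT; exists (fun=> 0) => x; exists (fun=> 0); rewrite big_ord0 subr0.
move=> [_ simp /IHs[y hy]].
have [[z0 hz0] _] := simple_line acyclic simp.
have [z ez] := mpi_surj z0.
exists (fun i => if i is j.+1 then y j else \val z) => x.
have [c hc] := hy x; have [k hk] := hz0 (Defs.mpi _ (SubmodOf hc)).
exists (fun i => if i is j.+1 then c j else k).
rewrite big_ord_recl /= opprD addrCA.
move: hk; rewrite ez mpi_scale => /eqP; rewrite mpi_eq inE.
by rewrite linearB linearZ /= addrC.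
Qed.

Lemma sum_base_mul n (U : lmodType L) (v : 'rV[K]_n) (A : 'M[K]_n) (y : nat -> U) :
  \sum_(i < n) base (v 0 i) *: (\sum_(j < n) base (A i j) *: y j) =
  \sum_(j < n) base ((v *m A) 0 j) *: y j.
Proof.
under eq_bigr do rewrite scaler_sumr; rewrite exchange_big /=.
apply: eq_bigr => j _; rewrite mxE rmorph_sum scaler_suml.
by apply: eq_bigr => i _; rewrite scalerA -rmorphM.
Qed.

Section Spanned.
Variables (U : lmodType L) (p : qpath Gamma) (u0 : U).
Hypotheses (u0_start : e_ (pstart p) *: u0 = u0) (pu0 : cls p *: u0 != 0).
Local Notation N := (plen p).
Local Notation u i := (cls (ptake i p) *: u0).

Lemma chain_neq0 i : u i != 0.
Proof.
apply/eqP => ui0; move/eqP: pu0; apply.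
by rewrite -(cls_drop_take p i) -scalerA ui0 scaler0.
Qed.

Lemma e_chain i j : (i <= N)%N -> (j <= N)%N ->
  e_ (pvert p j) *: u i = if i == j then u i else 0.
Proof.
move=> le_i le_j; rewrite scalerA e_cls pend_ptake //.
case: (eqVneq i j) => [->|ne]; first by rewrite eqxx.
case: eqP => [e|_]; last by rewrite scale0r.
by move/eqP: ne; case; apply: pvert_inj e.
Qed.

(** By Steinitz exchange: the elements [u i] lie at different vertices, hence
    are independent, and there are as many of them as composition factors. *)
Lemma chain_spans : has_length U N.+1 ->
  forall z, exists c : nat -> K, z = \sum_(i < N.+1) base (c i) *: u i.
Proof.
case=> s /series_span[y hy] sz; rewrite sz in hy.
(* [y] is a spanning family read off from the composition series, and [A] the
   matrix of the [u i] in terms of it. *)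
have spanned z : exists c : nat -> K, z = \sum_(i < N.+1) base (c i) *: y i.
  by have [c] := hy z; rewrite inE subr_eq0 => /eqP ->; exists c.
have [b hb] := choice spanned.
pose A : 'M[K]_N.+1 := \matrix_(i, j) b (u i) j.
have uE (i : 'I_N.+1) : u i = \sum_(j < N.+1) base (A i j) *: y j.
  by rewrite {1}(hb (u i)); apply: eq_bigr => j _; rewrite mxE.
have comb (v : 'rV[K]_N.+1) :
    \sum_(i < N.+1) base (v 0 i) *: u i = \sum_(j < N.+1) base ((v *m A) 0 j) *: y j.
  by rewrite -sum_base_mul; apply: eq_bigr => i _; rewrite -uE.
have Aunit : A \in unitmx.
  rewrite -row_free_unit; apply: inj_row_free => v vA; apply/rowP => i; rewrite mxE.
  have := comb v; rewrite vA [RHS]big1 => [|j _]; last by rewrite mxE rmorph0 scale0r.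
  move/(congr1 (fun z => e_ (pvert p i) *: z)).
  rewrite scaler0 scaler_sumr (bigD1 i) //= big1 => [|j ne]; last first.
    by rewrite baseZC (e_chain (leq_ord j) (leq_ord i)) (inj_eq val_inj) (negbTE ne) scaler0.
  rewrite addr0 baseZC (e_chain (leq_ord i) (leq_ord i)) eqxx => /base_eq0[//|ui0].
  by have := chain_neq0 i; rewrite ui0 eqxx.
move=> z; pose w : 'rV[K]_N.+1 := (\row_j b z j) *m invmx A.
exists (fun i => if insub i is Some j then w 0 j else 0).
under eq_bigr do rewrite valK.
rewrite comb mulmxKV // {1}(hb z); apply: eq_bigr => j _; by rewrite mxE.
Qed.

Hypothesis span : forall z, exists c : nat -> K, z = \sum_(i < N.+1) base (c i) *: u i.

Lemma e_line (z : U) j : (j <= N)%N -> exists k, e_ (pvert p j) *: z = base k *: u j.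
Proof.
move=> le_j; have [c ->] := span z; exists (c j).
rewrite scaler_sumr (bigD1 (Ordinal (le_j : (j < N.+1)%N))) //=.
rewrite big1 => [|i /negbTE ne]; first by rewrite addr0 baseZC e_chain // eqxx.
by rewrite baseZC (e_chain (leq_ord i) le_j) -(inj_eq val_inj) /= in ne *; rewrite ne scaler0.
Qed.

Lemma e_outside (z : U) v : v \notin pverts p -> e_ v *: z = 0.
Proof.
move=> nv; have [c ->] := span z; rewrite scaler_sumr big1 // => i _.
rewrite baseZC [X in base _ *: X]scalerA e_cls (pend_ptake (leq_ord i)).
case: eqP => [e|_]; last by rewrite scale0r scaler0.
by case/negP: nv; rewrite -e mem_pvert // leq_ord.
Qed.

Lemma ar_src a (M : lmodType L) (z : M) : ar a *: z = ar a *: (e_ (src a) *: z).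
Proof. by rewrite scalerA ar_e eqxx. Qed.

Lemma ar_tgt a (M : lmodType L) (z : M) : ar a *: z = e_ (tgt a) *: (ar a *: z).
Proof. by rewrite scalerA e_ar eqxx. Qed.

(** An arrow acting on [U] moves up along [p], so none ends at its start. *)
Lemma e_start_ar a (z : U) : e_ (pstart p) *: (ar a *: z) = 0.
Proof.
rewrite scalerA e_ar; case: eqP => [ta|_]; last by rewrite scale0r.
rewrite ar_src; case: (pvertP p (src a)) => [[i le_i sa]|/pvertP /e_outside ->]; last first.
  by rewrite scaler0.
by have := arrow_up acyclic (j := 0%N) le_i (leq0n _) (esym sa) ta.
Qed.

Fact e_start_kernel_closed : submod_closed [pred z : U | e_ (pstart p) *: z == 0].
Proof.
split=> [|r y z]; rewrite !inE; first by rewrite scaler0.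
move=> /eqP hy /eqP hz; apply/eqP; rewrite scalerDr hz addr0.
elim/gen_ind: r y hy => [r s hr hs y hy|r s hr hs y hy|k y hy|v y hy|a y _].
- by rewrite scalerDl scalerDr hr ?hs ?addr0.
- by rewrite -(scalerA r); apply: hr; apply: hs.
- by rewrite baseZC hy scaler0.
- by rewrite scalerA e_e; case: eqP => [->|_]; rewrite ?scale0r.
- exact: e_start_ar.
Qed.
Definition e_start_kernel : submodule U := Submodule e_start_kernel_closed.

Lemma e_start_kernelE (z : U) : (z \in e_start_kernel) = (e_ (pstart p) *: z == 0).
Proof. by []. Qed.

(** The left ideal of the [r] for which [r *: u0] has no component at the first
    vertex is maximal: modulo it every [r] is a scalar. *)
Lemma jacobson_u0 (j : L) : jacobson j -> j *: u0 \in e_start_kernel.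
Proof.
have closedM : submod_closed [pred r : L^o | (r : L) *: u0 \in e_start_kernel].
  split=> [|r x y hx hy]; first by rewrite inE scale0r rpred0.
  rewrite inE scalerDl; apply: rpredD => //.
  have -> : (r *: x : L) *: u0 = r *: ((x : L) *: u0) by rewrite scalerA.
  exact: rpredZ.
move=> /(_ (Submodule closedM)) h; apply: h; split.
  exists 1; apply/negP; rewrite inE scale1r e_start_kernelE u0_start.
  by have := chain_neq0 0; rewrite ptake0 u0_start => /negP.
move=> M MK; have [sub|] := pselect {subset M <= Submodule closedM}; first by left.
move=> /existsNP[x /not_implyP[xM xK]]; right.
have [k hk] := e_line ((x : L) *: u0) (leq0n N).
have k0 : k != 0.
  apply/eqP => k0; apply: xK; apply/eqP; move: hk.
  by rewrite pvert0 k0 rmorph0 scale0r.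
suff M1 : (1 : L^o) \in M.
  by move=> z; rewrite -[z](mulr1 (z : L)); apply: (rpredZ (z : L)) M1.
have -> : (1 : L^o) = (1 - base k^-1 * e_ (pstart p) * (x : L)) +
    (base k^-1 * e_ (pstart p)) *: x by rewrite subrK.
apply: rpredD; last exact: rpredZ.
apply: MK; apply/eqP; rewrite scalerBl scale1r -!scalerA hk ptake0.
by rewrite (scalerA (base k^-1) (base k)) -rmorphM mulVf // rmorph1 scale1r u0_start subrr scaler0.
Qed.

(** Arrows lie in the Jacobson radical, so the radical contains every [u i] with
    [i > 0]; conversely [jacobson_u0] bounds it, as the elements without
    component at the first vertex form a submodule. *)
Lemma rad_subE (z : U) : (z \in rad_sub U) = (e_ (pstart p) *: z == 0).
Proof.
rewrite -e_start_kernelE; apply/idP/idP.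
  move=> /asboolP; apply=> j x hj.
  have [k hk] := e_line x (leq0n N); rewrite pvert0 ptake0 u0_start in hk.
  have -> : j *: x = base k *: (j *: u0) + j *: (x - base k *: u0).
    by rewrite scalerBr -(baseZC k j) addrC subrK.
  apply: rpredD; first by apply: rpredZ; apply: jacobson_u0.
  by apply: rpredZ; rewrite e_start_kernelE scalerBr baseZC u0_start hk subrr.
rewrite e_start_kernelE => /eqP ez; apply/asboolP => M hM.
rewrite -(sum_e_scale z); apply: rpred_sum => v _.
case: (pvertP p v) => [[i le_i <-]|/pvertP /e_outside ->]; last exact: rpred0.
case: i le_i => [|i] le_i; first by rewrite pvert0 ez rpred0.
have [k ->] := e_line z le_i; apply: rpredZ.
have [a ap [sa _]] := parrow_at le_i.
by rewrite -(ar_ptake le_i ap) // -scalerA; apply: hM; apply: arrow_jacobson.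
Qed.

Lemma chain_in_rad i : (i <= N)%N -> (u i \in rad_sub U) = (0 < i)%N.
Proof.
move=> le_i; rewrite rad_subE -(pvert0 p) e_chain //.
by case: i le_i => [|i] _; rewrite ?eqxx ?(negbTE (chain_neq0 0)).
Qed.

Lemma chain_generates (z : U) : exists r : L, z = r *: u0.
Proof.
have [c ->] := span z; exists (\sum_(i < N.+1) base (c i) * cls (ptake i p)).
by rewrite scaler_suml; apply: eq_bigr => i _; rewrite scalerA.
Qed.

End Spanned.
End Chain.

(** * Sufficiency *)

Section Sufficiency.
Variables (K : fieldType) (Gamma : quiver) (L : monomial_ring K Gamma).
Local Notation cls := (@cls K Gamma L).
Local Notation base := (@base K Gamma L).
Local Notation e_ v := (cls (vpath v)).
Local Notation ar a := (cls (apath a)).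
Hypothesis acyclic : triangular Gamma.
Variables (U : lmodType L) (p : qpath Gamma) (u0 : U).
Local Notation N := (plen p).
Local Notation u i := (cls (ptake i p) *: u0).
Hypotheses (u0_start : e_ (pstart p) *: u0 = u0) (pu0 : cls p *: u0 != 0).
Hypothesis span : forall z, exists c : nat -> K, z = \sum_(i < N.+1) base (c i) *: u i.

(** Conditions (a) and (b), with the classes of arrows merged: an arrow that is
    not on [p], but touches [p] at the vertex in question, belongs to B or D,
    respectively to C or D, according to the position of its other end. *)
Definition no_exit := forall a i, a \notin parrows p -> (i < N)%N ->
  src a = pvert p i -> ar a * cls (ptake i p) = 0.

Definition no_entry := forall b, src b = pend p -> ar b * cls p != 0 ->
  forall c i, c \notin parrows p -> (0 < i <= N)%N -> tgt c = pvert p i ->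
    ar b * cls (pdrop i p) * ar c = 0.

(** An arrow starting at the end of [p] cannot return to a vertex of [p]. *)
Lemma end_arrow b (z : U) : src b = pend p -> ar b *: z = 0.
Proof.
move=> sb; rewrite ar_tgt (e_outside span) //.
apply/negP => /pvertP[j le_j /esym tb].
have := arrow_up acyclic (leqnn N) le_j; rewrite pvert_plen => /(_ b sb tb).
by rewrite ltnNge le_j.
Qed.

Lemma off_chain a (z : U) : no_exit -> a \notin parrows p -> ar a *: z = 0.
Proof.
move=> noexit ap; rewrite ar_src.
case: (pvertP p (src a)) => [[i le_i sa]|/pvertP]; last first.
  by move=> /(e_outside span) ->; rewrite scaler0.
rewrite -sa; have [k ->] := e_line acyclic span z le_i.
move: le_i; rewrite leq_eqVlt => /predU1P[ei|lt_i].
  by apply: end_arrow; rewrite -sa ei pvert_plen.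
by rewrite baseZC (scalerA (ar a)) noexit // scale0r scaler0.
Qed.

Lemma chain_start_inj k l : base k *: u0 = base l *: u0 -> k = l.
Proof.
move=> /eqP; rewrite -subr_eq0 -scalerBl -rmorphB => /eqP /base_eq0[/eqP|u00].
  by rewrite subr_eq0 => /eqP.
by have := chain_neq0 pu0 0; rewrite u00 scaler0 eqxx.
Qed.

(** The elements [p_i y] span a submodule: an arrow either moves along the chain,
    or leaves it early and acts as zero, or starts at its end. *)
Lemma chain_span (M : lmodType L) (y : M) : no_exit ->
    e_ (pstart p) *: y = y -> (forall b, src b = pend p -> ar b *: (cls p *: y) = 0) ->
  forall r : L, exists c : nat -> K,
    r *: y = \sum_(i < N.+1) base (c i) *: (cls (ptake i p) *: y).
Proof.
move=> noexit ey ky r.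
pose S z := exists c : nat -> K, z = \sum_(i < N.+1) base (c i) *: (cls (ptake i p) *: y).
have S0 : S 0 by exists (fun=> 0); rewrite big1 // => i _; rewrite rmorph0 scale0r.
have SD z t : S z -> S t -> S (z + t).
  move=> [c ->] [d ->]; exists (fun i => c i + d i); rewrite -big_split /=.
  by apply: eq_bigr => i _; rewrite rmorphD scalerDl.
have SZ k z : S z -> S (base k *: z).
  move=> [c ->]; exists (fun i => k * c i); rewrite scaler_sumr.
  by apply: eq_bigr => i _; rewrite rmorphM scalerA.
have Sw i : (i <= N)%N -> S (cls (ptake i p) *: y).
  move=> le_i; exists (fun j => if j == i then 1 else 0).
  have ltN : (i < N.+1)%N by [].
  rewrite (bigD1 (Ordinal ltN)) //= eqxx rmorph1 scale1r big1 ?addr0 // => j ne.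
  by rewrite -(inj_eq val_inj) /= in ne; rewrite (negbTE ne) rmorph0 scale0r.
have Sgen (x : L) : (forall i, (i <= N)%N -> S (x *: (cls (ptake i p) *: y))) ->
    forall z, S z -> S (x *: z).
  move=> hx z [c ->]; rewrite scaler_sumr; apply: big_ind => // i _.
  by rewrite baseZC; apply: SZ; apply: hx; apply: leq_ord.
suff SL z : S z -> S (r *: z).
  by apply: SL; have := Sw 0%N (leq0n _); rewrite ptake0 ey.
elim/gen_ind: r z => [r s hr hs z Sz|r s hr hs z Sz|k z|v|a].
- by rewrite scalerDl; apply: SD; [apply: hr|apply: hs].
- by rewrite -scalerA; apply: hr; apply: hs.
- exact: SZ.
- apply: Sgen => i le_i; rewrite scalerA e_cls.
  by case: eqP => _; [apply: Sw|rewrite scale0r].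
- apply: Sgen => i le_i; rewrite scalerA.
  case: (eqVneq (src a) (pvert p i)) => [sa|nsa]; last first.
    by rewrite cls_comp0 ?scale0r // pend_ptake // eq_sym.
  have [ap|nap] := boolP (a \in parrows p).
    have lt_i : (i < N)%N by rewrite -(parrow_index acyclic ap le_i sa) index_mem.
    by rewrite (ar_ptake L acyclic lt_i ap sa); apply: Sw.
  move: (le_i); rewrite leq_eqVlt => /predU1P[ei|lt_i].
    by rewrite -scalerA ei ptake_plen ky // sa ei pvert_plen.
  by rewrite noexit // scale0r.
Qed.

(** Apply [chain_span] to [(u0, y)]: the coefficients of [r *: u0] and [r *: y]
    agree, and those of [r *: u0] are unique. *)
Lemma chain_annihilator (M : lmodType L) (y : M) : no_exit ->
    e_ (pstart p) *: y = y -> (forall b, src b = pend p -> ar b *: (cls p *: y) = 0) ->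
  forall r : L, r *: u0 = 0 -> r *: y = 0.
Proof.
move=> noexit ey ky r ru0.
have [||c] := @chain_span (U * M)%type (u0, y) noexit _ _ r.
- by congr pair.
- by move=> b sb; congr pair; rewrite /= ?ky //; apply: end_arrow.
move=> rE; have r1 := congr1 fst rE; have r2 := congr1 snd rE.
have pr1 (s : 'I_N.+1 -> (U * M)%type) : (\sum_i s i).1 = \sum_i (s i).1.
  by apply: (big_morph fst).
have pr2 (s : 'I_N.+1 -> (U * M)%type) : (\sum_i s i).2 = \sum_i (s i).2.
  by apply: (big_morph snd).
rewrite /= pr1 ru0 in r1; rewrite /= pr2 in r2.
rewrite r2 big1 // => i _ /=; suff -> : c i = 0 by rewrite rmorph0 scale0r.
have := congr1 (fun z => e_ (pvert p i) *: z) (esym r1).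
rewrite scaler0 scaler_sumr (bigD1 i) //= big1 => [|j ne]; last first.
  rewrite baseZC (e_chain acyclic u0 (leq_ord j) (leq_ord i)).
  by rewrite (inj_eq val_inj) (negbTE ne) scaler0.
rewrite addr0 baseZC (e_chain acyclic u0 (leq_ord i) (leq_ord i)) eqxx.
by move=> /base_eq0[//|ui0]; have := chain_neq0 pu0 i; rewrite ui0 eqxx.
Qed.

Section Factorization.
Hypotheses (noexit : no_exit) (noentry : no_entry).
Local Notation J := (submod_of (rad_sub U)).
Variables (X : lmodType L) (h : {linear J -> X}) (g : {linear X -> U}).
Hypothesis hg : forall x, rad_incl U x = g (h x).

(** Records the action of all the arrows that extend [p] to a nonzero path. *)
Definition end_arrows (y : X) : {ffun arrow Gamma -> X} :=
  [ffun b => if (src b == pend p) && (ar b * cls p != 0) then ar b *: y else 0].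

Lemma end_arrows_linear : linear (end_arrows : base_mod X -> base_mod {ffun arrow Gamma -> X}).
Proof.
move=> k y z; apply/ffunP => b; rewrite !ffunE; case: ifP => _.
  by rewrite scalerDr -baseZC.
by rewrite scaler0 addr0.
Qed.

Lemma end_arrows0 y : (forall b, src b = pend p -> ar b * cls p != 0 -> ar b *: y = 0) ->
  end_arrows y = 0.
Proof.
by move=> hy; apply/ffunP => b; rewrite !ffunE; case: ifP => // /andP[/eqP sb nb]; apply: hy.
Qed.

Lemma end_arrowsP y b : end_arrows y = 0 -> src b = pend p -> ar b * cls p != 0 ->
  ar b *: y = 0.
Proof. by move=> /ffunP /(_ b); rewrite !ffunE => + sb nb; rewrite sb eqxx nb. Qed.

Lemma section_of_element x k : k != 0 -> e_ (pstart p) *: g x = base k *: u0 ->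
  end_arrows (cls p *: x) = 0 -> split_epi g.
Proof.
move=> k0 gx ax; pose y := base k^-1 *: (e_ (pstart p) *: x).
have gy : g y = u0.
  by rewrite /y !linearZ /= gx scalerA -rmorphM mulVf // rmorph1 scale1r.
have ey : e_ (pstart p) *: y = y.
  by rewrite /y baseZC (scalerA (e_ _)) e_e eqxx.
have ky b : src b = pend p -> ar b *: (cls p *: y) = 0.
  move=> sb; rewrite /y !baseZC (scalerA (cls p)) cls_e_pstart.
  have [nb|nb] := eqVneq (ar b * cls p) 0; first by rewrite (scalerA (ar b)) nb scale0r scaler0.
  by rewrite (end_arrowsP ax) ?scaler0.
have [F FE] := cyclic_map (chain_generates span) (chain_annihilator noexit ey ky).
exists F => z; have [r ->] := chain_generates span z.
by rewrite FE linearZ /= gy.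
Qed.

(** The comparison map: a functional [psi] on [X] that is killed by the paths
    entering the mast extends along the mast to a map into [U]. *)
Lemma map_of_functional (psi : X -> K) :
    {morph psi : x y / x + y} -> (forall k x, psi (base k *: x) = k * psi x) ->
    (forall a i x, a \notin parrows p -> (i <= N)%N -> tgt a = pvert p i ->
       psi ((cls (pdrop i p) * ar a) *: x) = 0) ->
  exists t : {linear X -> U}, forall x,
    t x = \sum_(i < N.+1) base (psi (cls (pdrop i p) *: x)) *: u i.
Proof.
move=> psiD psiZ psi_entry.
have psi0 : psi 0 = 0 by apply: (addrI (psi 0)); rewrite -psiD !addr0.
pose t x := \sum_(i < N.+1) base (psi (cls (pdrop i p) *: x)) *: u i.
have [|t' tE] := @linear_map _ _ _ t; last by exists t'.
apply: linear_on_gens => [x y|k x|v x|a x].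
- rewrite /t -big_split /=; apply: eq_bigr => i _.
  by rewrite scalerDr psiD rmorphD scalerDl.
- rewrite /t scaler_sumr; apply: eq_bigr => i _.
  by rewrite baseZC psiZ rmorphM -scalerA.
- rewrite /t scaler_sumr; apply: eq_bigr => i _.
  rewrite baseZC !scalerA -mulrA e_cls cls_e -[pstart _]/(pend (ptake i p)).
  by case: eqP => _ //; rewrite mulr0 !scale0r psi0 rmorph0 mul0r scale0r.
have [ap|nap] := boolP (a \in parrows p); last first.
  rewrite (off_chain _ noexit nap) /t big1 // => i _.
  rewrite (scalerA _ (ar a)); case: (eqVneq (tgt a) (pstart (pdrop i p))) => [ta|nta].
    by rewrite psi_entry ?leq_ord ?rmorph0 ?scale0r // ta pstart_pdrop ?leq_ord.
  by rewrite cls_comp0 // scale0r psi0 rmorph0 scale0r.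
have [sa ta] := parrow_ends ap; set j := index a (parrows p) in sa ta.
have lt_j : (j < N)%N by rewrite index_mem.
have ltj : (j < N.+1)%N by apply: ltnW.
rewrite /t scaler_sumr (bigD1 (Ordinal (lt_j : (j.+1 < N.+1)%N))) //= big1 => [|i ne]; last first.
  rewrite (scalerA _ (ar a)) cls_comp0 ?scale0r ?psi0 ?rmorph0 ?scale0r // pstart_pdrop ?leq_ord //.
  rewrite -[pend _]/(tgt a) ta; apply: contra_neq ne.
  by move=> /(pvert_inj acyclic lt_j (leq_ord i)) e; apply: val_inj.
rewrite addr0 (bigD1 (Ordinal ltj)) //= big1 => [|i ne]; last first.
  rewrite baseZC ar_src sa (e_chain acyclic u0 (leq_ord i) (ltnW lt_j)).
  by rewrite -(inj_eq val_inj) /= in ne; rewrite (negbTE ne) !scaler0.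
rewrite addr0 baseZC (scalerA (ar a)) (ar_ptake L acyclic lt_j ap sa).
by rewrite (scalerA _ (ar a)) (pdrop_ar L acyclic lt_j ap sa).
Qed.

Lemma factor_splits : split_mono h \/ split_epi g.
Proof.
have coordE x : exists k, e_ (pstart p) *: g x = base k *: u0.
  have := e_line acyclic span (g x) (leq0n N).
  by rewrite pvert0 ptake0 u0_start.
have [c cE] := choice coordE.
have cL : scalar (c : base_mod X -> K).
  move=> k x y; apply: chain_start_inj; rewrite -cE rmorphD scalerDl -cE rmorphM -scalerA -cE.
  by rewrite linearD linearZ /= scalerDr baseZC.
have [T TE] := linear_map end_arrows_linear.
have [P PE] : exists P : {linear base_mod X -> base_mod X}, P =1 (fun x : X => cls p *: x).
  by apply: linear_map => k x y; rewrite scalerDr; congr (_ + _); apply: baseZC.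
(* [c x] is the coefficient of [u0] in [g x], and [P] the action of [p]. *)
have [[x [Tx cx]]|none] := pselect (exists x, T (P x) = 0 /\ c x != 0).
  right; apply: (section_of_element cx (cE x)).
  by rewrite -TE -PE.
left.
have [|phi phiL phiE] := @functional_factor _ _ _ (T \o P) c cL.
  move=> x Tx; apply/eqP/negPn/negP => cx; apply: none; by exists x.
have phi0 : phi 0 = 0.
  have := phiL 0 0 0; rewrite scaler0 addr0 mul0r add0r => _.
  by have := phiL (-1) 0 0; rewrite scaler0 addr0 mulN1r addrC subrr.
pose psi (x : X) := phi (T x).
have psiD : {morph psi : x y / x + y}.
  by move=> x y; rewrite /psi linearD -[X in X + _]scale1r phiL mul1r.
have psiZ k x : psi (base k *: x) = k * psi x.
  have TZ : T (base k *: x) = k *: T x :> base_mod _ by exact: (linearZ_LR T k x).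
  by rewrite /psi TZ -[X in phi X]addr0 phiL phi0 addr0.
have psi_end x : (forall b, src b = pend p -> ar b * cls p != 0 -> ar b *: x = 0) -> psi x = 0.
  by move=> hx; rewrite /psi TE end_arrows0.
have psi_p x : psi (cls p *: x) = c x by rewrite phiE /= PE.
have [|t tE] := map_of_functional psiD psiZ.
  move=> a [|i] x nap le_i ta.
    rewrite -scalerA pdrop0 psi_p; apply: chain_start_inj.
    by rewrite -cE linearZ /= (off_chain _ noexit nap) scaler0 rmorph0 scale0r.
  apply: psi_end => b sb nb; rewrite scalerA mulrA noentry ?scale0r //.
(* [t] and [g] agree at the first vertex, so their difference maps to the
   radical; and [t] vanishes on the image of [h]. *)
have [r rE] : exists r : {linear X -> U}, r =1 (fun x => g x - t x).
  by apply: linear_map => k x y; rewrite (linearP g) (linearP t) scalerBr opprD addrACA.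
have [|rho rhoE] := @corestrict_map _ _ _ (rad_sub U) r.
  move=> x; rewrite (rad_subE acyclic u0_start pu0 span) rE scalerBr cE tE.
  rewrite scaler_sumr (bigD1 ord0) //= big1 => [|i ne].
    by rewrite pdrop0 psi_p baseZC ptake0 u0_start u0_start addr0 subrr.
  rewrite baseZC -(pvert0 p) (e_chain acyclic u0 (leq_ord i) (leq0n N)).
  by rewrite -(inj_eq val_inj) /= in ne; rewrite (negbTE ne) scaler0.
exists rho => x; apply: val_inj; rewrite rhoE rE -hg tE big1 ?subr0 // => i _.
rewrite psi_end ?rmorph0 ?scale0r // => b sb _.
rewrite -!linearZ /= -[RHS](linear0 h); congr (h _); apply: val_inj.
by rewrite linearZ /= end_arrow.
Qed.

End Factorization.

Lemma length1_simple : N = 0%N -> simple_module U.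
Proof.
move=> N0; have u00 : u0 != 0.
  by have := chain_neq0 pu0 0; rewrite ptake0 u0_start.
split; first by exists u0.
move=> M; have [[z [zM z0]]|none] := pselect (exists z, z \in M /\ z != 0); last first.
  left=> z zM; apply/eqP/negPn/negP => z0; apply: none; by exists z.
right=> y; have [r ->] := chain_generates span y; apply: rpredZ.
have [c zE] := span z; rewrite N0 big_ord1 ptake0 u0_start in zE.
have c0 : c 0%N != 0.
  by apply/eqP => c0; move: z0; rewrite zE c0 rmorph0 scale0r eqxx.
have -> : u0 = base (c 0%N)^-1 *: z.
  by rewrite zE scalerA -rmorphM mulVf // rmorph1 scale1r.
exact: rpredZ.
Qed.

Lemma irreducible_inclusion : ~ simple_module U -> no_exit -> no_entry ->
  irreducible_map (rad_incl U).
Proof.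
move=> nsimple noexit noentry; split.
- move=> [rho rhoE].
  have N0 : (0 < N)%N.
    by rewrite lt0n; apply/eqP => /length1_simple.
  have u1J : u 1 \in rad_sub U by rewrite (chain_in_rad acyclic u0_start pu0 span).
  have [a ap [sa _]] := parrow_at N0.
  have u1E : u 1 = ar a *: u0.
    by rewrite -(ar_ptake L acyclic N0 ap) // ptake0 -scalerA u0_start.
  have := rhoE (SubmodOf u1J); rewrite /= {1}u1E linearZ /= => e.
  have rho0 : \val (rho u0) = 0.
    rewrite -u0_start linearZ /=.
    by have := valP (rho u0); rewrite (rad_subE acyclic u0_start pu0 span) => /eqP.
  have := congr1 val e; rewrite linearZ /= rho0 scaler0 => u10.
  by have := chain_neq0 pu0 1; rewrite -u10 eqxx.
- move=> [r rE]; have := chain_in_rad acyclic u0_start pu0 span (leq0n N).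
  rewrite ptake0 u0_start ltnn => /negP; apply.
  by rewrite -(rE u0); apply: valP.
- by move=> X h g _ hg; apply: factor_splits.
Qed.

End Sufficiency.

(** * Necessity *)

Section Necessity.
Variables (K : fieldType) (Gamma : quiver) (L : monomial_ring K Gamma).
Local Notation cls := (@cls K Gamma L).
Local Notation base := (@base K Gamma L).
Local Notation e_ v := (cls (vpath v)).
Local Notation ar a := (cls (apath a)).
Hypothesis acyclic : triangular Gamma.
Variables (U : lmodType L) (p : qpath Gamma) (u0 : U).
Local Notation N := (plen p).
Local Notation u i := (cls (ptake i p) *: u0).
Hypotheses (u0_start : e_ (pstart p) *: u0 = u0) (pu0 : cls p *: u0 != 0).
Hypothesis span : forall z, exists c : nat -> K, z = \sum_(i < N.+1) base (c i) *: u i.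
Local Notation J := (submod_of (rad_sub U)).

Section TestModule.
Variables (Y : lmodType L) (f f' : Y).
Hypothesis f_start : e_ (pstart p) *: f = f.

Fact test_closed : submod_closed [pred z : U * Y |
  `[< exists (r s : L) (j : U), j \in rad_sub U /\ z = (r *: u0 + j, r *: f + s *: f') >]].
Proof.
split=> [|k z t /asboolP[r [s [j [jJ ->]]]] /asboolP[r' [s' [j' [jJ' ->]]]]].
  apply/asboolP; exists 0, 0, 0; split; first exact: rpred0.
  by rewrite !scale0r !addr0.
apply/asboolP; exists (k * r + r'), (k * s + s'), (k *: j + j'); split.
  by apply: rpredD => //; apply: rpredZ.
by congr pair; rewrite /= !scalerDl !scalerDr !scalerA addrACA.
Qed.
Definition test_module : submodule (U * Y)%type := Submodule test_closed.
Local Notation X := (submod_of test_module).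

Lemma test_moduleP (z : X) : exists (r s : L) (j : U),
  j \in rad_sub U /\ \val z = (r *: u0 + j, r *: f + s *: f').
Proof. by have /asboolP := valP z. Qed.

Fact test_mem1 : ((u0, f) : U * Y) \in test_module.
Proof.
apply/asboolP; exists 1, 0, 0; split; first exact: rpred0.
by rewrite !scale1r scale0r !addr0.
Qed.
Fact test_mem2 : ((0, f') : U * Y) \in test_module.
Proof.
apply/asboolP; exists 0, 1, 0; split; first exact: rpred0.
by rewrite !scale0r scale1r !add0r.
Qed.
Fact test_mem3 (j : J) : ((\val j, 0) : U * Y) \in test_module.
Proof.
apply/asboolP; exists 0, 0, (\val j); split; first exact: valP.
by rewrite !scale0r !add0r.
Qed.

Lemma test_incl : exists h : {linear J -> X}, forall j, \val (h j) = (\val j, 0).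
Proof.
have [h hE] : exists h : {linear J -> (U * Y)%type}, forall j, h j = (\val j, 0).
  apply: linear_map => k x y; congr pair => //.
  by rewrite /= scaler0 addr0.
have [|h' h'E] := @corestrict_map _ _ _ test_module h.
  by move=> j; rewrite hE; apply: test_mem3.
by exists h' => j; rewrite h'E hE.
Qed.

Lemma test_proj : exists g : {linear X -> U}, forall z, g z = (\val z).1.
Proof. by apply: linear_map. Qed.

(** Besides the two given elements, the generators are the [u i] in the radical;
    [insubd 0] replaces [u 0], which is not there, by 0. *)
Lemma test_fin_gen : fin_gen X.
Proof.
have [h hE] := test_incl.
exists (SubmodOf test_mem1 :: SubmodOf test_mem2 ::
  [seq h (insubd 0 (u i)) | i <- iota 0 N.+1]).
move=> M sub z; have [r [s [j [jJ zE]]]] := test_moduleP z.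
have zE' : z = r *: SubmodOf test_mem1 + s *: SubmodOf test_mem2 + h (SubmodOf jJ).
  apply: val_inj; rewrite zE !linearD !linearZ /= hE.
  by congr pair; rewrite /= ?scaler0 !addr0.
rewrite zE'; apply: rpredD; first apply: rpredD; try apply: rpredZ.
- by apply: sub; rewrite mem_head.
- by apply: sub; rewrite !inE eqxx orbT.
have [c jE] := span j.
have -> : SubmodOf jJ = \sum_(i < N.+1) base (c i) *: insubd 0 (u i).
  apply: val_inj; rewrite linear_sum -[LHS]/j {1}jE; apply: eq_bigr => i _.
  transitivity (base (c i) *: \val (insubd (0 : J) (u i))) => //.
  rewrite val_insubd (chain_in_rad acyclic u0_start pu0 span) ?leq_ord //.
  case: (posnP i) => [i0|//]; rewrite i0 ptake0 u0_start.
  have -> : \val (0 : J) = 0 by [].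
  rewrite scaler0.
  have := jJ; rewrite (rad_subE acyclic u0_start pu0 span) jE => /eqP.
  rewrite scaler_sumr (bigD1 ord0) //= big1 => [|k ne].
    by rewrite addr0 ptake0 u0_start baseZC u0_start.
  rewrite baseZC -(pvert0 p) (e_chain acyclic u0 (leq_ord k) (leq0n N)).
  by rewrite -(inj_eq val_inj) /= in ne; rewrite (negbTE ne) scaler0.
rewrite linear_sum; apply: rpred_sum => i _; rewrite linearZ; apply: rpredZ.
apply: sub; rewrite 2!in_cons; apply/or3P/Or33.
by apply/mapP; exists (i : nat); rewrite // mem_iota /= add0n.
Qed.

(** The inclusion of the radical factors through the submodule of [U * Y]
    generated by the radical, [(u0, f)] and [(0, f')].  A retraction sends
    [(u0, f)] to 0, as the radical has no component at the first vertex; a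
    section sends [u0] to [(u0, f)], up to a multiple of [f']. *)
Lemma irreducible_test : irreducible_map (rad_incl U) ->
  (exists y : U, forall r s : L, r *: u0 \in rad_sub U -> r *: f + s *: f' = 0 ->
     s *: y = r *: u0) \/
  (exists s : L, forall r : L, r *: u0 = 0 -> r *: (f + (e_ (pstart p) * s) *: f') = 0).
Proof.
have [h hE] := test_incl; have [g gE] := test_proj.
move=> [_ _ /(_ X h g test_fin_gen)[j|[rho rhoE]|[sigma sigmaE]]].
- by rewrite gE hE.
- left; exists (\val (rho (SubmodOf test_mem2))) => r s rJ rs0.
  have rho0 : \val (rho (SubmodOf test_mem1)) = 0.
    have -> : SubmodOf test_mem1 = e_ (pstart p) *: SubmodOf test_mem1.
      by apply: val_inj; rewrite linearZ /=; congr pair; rewrite /= ?u0_start ?f_start.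
    rewrite linearZ /=; apply/eqP.
    by rewrite -(rad_subE acyclic u0_start pu0 span); apply: valP.
  have : r *: SubmodOf test_mem1 + s *: SubmodOf test_mem2 = h (SubmodOf rJ).
    apply: val_inj; rewrite hE linearD !linearZ /=.
    by congr pair; rewrite //= scaler0 addr0.
  move/(congr1 (fun z => \val (rho z))); rewrite rhoE linearD !linearZ /=.
  by rewrite rho0 scaler0 add0r.
right; have [r [s [j [jJ sE]]]] := test_moduleP (sigma u0).
(* At the first vertex, [r] acts as a scalar [k], which is 1 by [sigmaE]. *)
have [k kE] := e_loop acyclic (pstart p) r.
have r_e (W : lmodType L) (w : W) : e_ (pstart p) *: w = w ->
    e_ (pstart p) *: (r *: w) = base k *: w.
  by move=> ew; rewrite -{1}ew !scalerA kE -scalerA ew.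
have k1 : k = 1.
  have := sigmaE u0; rewrite gE sE /= => /(congr1 (fun z => e_ (pstart p) *: z)).
  rewrite scalerDr r_e // u0_start.
  move: jJ; rewrite (rad_subE acyclic u0_start pu0 span) => /eqP ->.
  by rewrite addr0 -[X in _ = X]scale1r -(rmorph1 base) => /(chain_start_inj pu0).
have sigma_u0 : (\val (sigma u0)).2 = f + (e_ (pstart p) * s) *: f'.
  rewrite -u0_start linearZ linearZ /= sE /= scalerDr r_e // k1 rmorph1 scale1r.
  by rewrite scalerA.
exists s => t tu0; rewrite -sigma_u0.
have := congr1 (fun z => (\val (sigma z)).2) tu0.
by rewrite linearZ linearZ linear0.
Qed.

End TestModule.

Hypothesis irr : irreducible_map (rad_incl U).

Lemma pcomp_cls q r : cls q * cls r != 0 -> exists w,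
  [/\ cls q * cls r = cls w, pstart w = pstart r, pend r = pstart q
    & parrows w = parrows r ++ parrows q].
Proof.
case: (pcompP q r) => [w e sw ew aw _|ne]; last by rewrite cls_comp0 ?eqxx.
by exists w; rewrite (cls_comp q r w).
Qed.

(** If [U] is simple, its radical is zero and the inclusion is a split mono. *)
Lemma irreducible_not_simple : ~ simple_module U.
Proof.
move=> [_ /(_ (rad_sub U))[J0|JT]].
  have [nmono _ _] := irr; apply: nmono.
  have [|rho _] := @linear_map L U J (fun=> 0).
    by move=> k x y; rewrite scaler0 addr0.
  exists rho => x; apply: val_inj.
  by rewrite [LHS](J0 _ (valP _)); apply/esym/J0/valP.
have := chain_in_rad acyclic u0_start pu0 span (leq0n N).
by rewrite JT.
Qed.

(** If [w] leaves the mast along [a], test against the coefficient of [w]: the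
    next arrow of the mast annihilates it, but not its counterpart in [U]. *)
Lemma irreducible_no_exit : no_exit L p.
Proof.
move=> a i nap lt_i sa; apply/eqP/negPn/negP => w_neq0.
have [w [wE sw _ aw]] := pcomp_cls w_neq0; rewrite wE in w_neq0.
have [F FE] := coefficient_exists w_neq0.
have Fw : F (cls w) = 1 by rewrite (coefficient_cls _ FE) eqxx.
have F_start : e_ (pstart p) *: F = F.
  by have := coefficient_start FE; rewrite sw.
have [[y yE]|[s sE]] := irreducible_test 0 F_start irr.
  have F0 : cls (ptake i.+1 p) *: F + 0 *: (0 : coind L K) = 0.
    rewrite scaler0 addr0; apply/val_inj/funext => x.
    apply: (coefficient_mulr0 _ FE) => t; rewrite aw /ptake /parrows /= -/(parrows p).
    have [b bp _] := parrow_at lt_i.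
    rewrite (take_nth b) // -cats1 -catA => /eqP; rewrite eqseq_cat // => /andP[_ /eqP[ea _]].
    by case/negP: nap; rewrite ea mem_nth.
  have := yE _ _ _ F0; rewrite (chain_in_rad acyclic u0_start pu0 span) // => /(_ isT) /esym/eqP.
  by rewrite scale0r (negbTE (chain_neq0 pu0 i.+1)).
have {}sE r : r *: u0 = 0 -> F r = 0.
  move=> /sE; rewrite scaler0 addr0 => /(congr1 (fun f : coind L K => f 1)).
  by rewrite coindZE mul1r.
have [tap|/pvertP] := boolP (tgt a \in pverts p); last first.
  move=> tap; have := sE (cls w); rewrite Fw.
  rewrite -wE -scalerA ar_tgt (e_outside span) //; last exact/pvertP.
  by move=> /(_ erefl) /eqP; rewrite oner_eq0.
(* In [U] the arrow [a] may act as a multiple of a segment of [p]; the difference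
   annihilates [u0], but has coefficient 1 at [w]. *)
have [j le_j tj] := pvertP _ _ tap.
have [k kE] := e_line acyclic span (ar a *: u i) le_j.
have := sE (cls w - base k * cls (ptake j p)).
rewrite scalerBl -wE -scalerA ar_tgt -tj kE scalerA subrr => /(_ erefl).
rewrite coindD -mulNr -(rmorphN base) FE wE Fw; case: eqP => [e|_] /eqP.
  case/negP: nap; have : a \in parrows w by rewrite aw mem_cat inE eqxx orbT.
  by rewrite -e => /mem_take.
by rewrite addr0 oner_eq0.
Qed.

(** If [c] enters the mast and both paths continue with [b], test against the
    coefficients of [b p] and of the path entering along [c]. *)
Lemma irreducible_no_entry : no_entry L p.
Proof.
move=> b sb w1_neq0 c i ncp /andP[i_gt0 le_i] tc; apply/eqP/negPn/negP => w2_neq0.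
have w_neq0 : ar b * cls (pdrop i p) != 0.
  by apply: contra_neq w2_neq0 => ->; rewrite mul0r.
have [w1 [w1E sw1 _ aw1]] := pcomp_cls w1_neq0; rewrite w1E in w1_neq0.
have [w [wE sw _ aw]] := pcomp_cls w_neq0; rewrite wE in w_neq0 w2_neq0.
have [w2 [w2E sw2 ew2 aw2]] := pcomp_cls w2_neq0; rewrite w2E in w2_neq0.
have [F1 F1E] := coefficient_exists w1_neq0.
have [F2 F2E] := coefficient_exists w2_neq0.
have [F FE] := coefficient_exists w_neq0.
have F_start : e_ (pstart p) *: F1 = F1.
  by have := coefficient_start F1E; rewrite sw1.
have [[y yE]|[s sE]] := irreducible_test F2 F_start irr.
  have F0 : cls (ptake i p) *: F1 + (- ar c) *: F2 = 0.
    apply/eqP; rewrite scaleNr subr_eq0; apply/eqP/val_inj/funext => x /=.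
    transitivity (F x); last first.
      by apply/esym/(coefficient_mulr x F2E FE).
    apply: (coefficient_mulr x F1E FE) => //.
    by rewrite aw1 aw catA cat_take_drop.
  have := yE _ _ _ F0; rewrite (chain_in_rad acyclic u0_start pu0 span) // => /(_ i_gt0) /esym/eqP.
  rewrite scaleNr (off_chain acyclic span y irreducible_no_exit ncp) oppr0.
  by rewrite (negbTE (chain_neq0 pu0 i)).
(* It remains to see that [w2] does not end with [w1], which holds because it is
   not longer and does not start with the first arrow of [p]. *)
have := sE (cls w1); rewrite -w1E -scalerA (end_arrow acyclic span) // w1E.
move=> /(_ erefl) /(congr1 (fun f : coind L K => f 1)); rewrite coindZE mul1r.
rewrite coindDE coindZE (coefficient_cls _ F1E) eqxx.
rewrite (coefficient_mull0 _ F2E) => [/eqP|t]; first by rewrite addr0 oner_eq0.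
rewrite aw2 aw aw1 => e; have := congr1 size e.
rewrite !size_cat /pdrop /parrows /= size_drop -!/(parrows _) -!/(plen p) => sz.
have t0 : t = [::].
  case: (t) sz => // d t' /eqP; rewrite ltn_eqF // !addn1 add1n /= addSn ltnS.
  rewrite (leq_trans _ (leq_addl _ _)) // ltnS ltn_subrL i_gt0.
  exact: leq_trans i_gt0 le_i.
move: e; rewrite t0 /=; case E : (parrows p) => [|d s'].
  by have := leq_trans i_gt0 le_i; rewrite /plen E.
by case=> cd; rewrite E cd mem_head in ncp.
Qed.

End Necessity.

(** * The equivalence *)

Section Equivalence.
Variables (K : fieldType) (Gamma : quiver) (L : monomial_ring K Gamma).
Hypothesis acyclic : triangular Gamma.

Theorem irreducible_inclusionP (U : lmodType L) (p : qpath Gamma) :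
    has_length U (plen p).+1 -> (exists x : U, cls p *: x != 0) ->
  irreducible_map (rad_incl U) <-> [/\ ~ simple_module U, no_exit L p & no_entry L p].
Proof.
move=> lenU [x px]; pose u0 := cls (vpath (pstart p)) *: x.
have u0_start : cls (vpath (pstart p)) *: u0 = u0 by rewrite scalerA e_e eqxx.
have pu0 : cls p *: u0 != 0 by rewrite scalerA cls_e_pstart.
have span := chain_spans acyclic pu0 lenU.
split=> [irr|[nsimple noexit noentry]].
  split; first exact: (irreducible_not_simple acyclic u0_start pu0 span irr).
    exact: (irreducible_no_exit acyclic u0_start pu0 span irr).
  exact: (irreducible_no_entry acyclic u0_start pu0 span irr).
exact: (irreducible_inclusion acyclic u0_start pu0 span nsimple noexit noentry).
Qed.

End Equivalence.

Section Conditions.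
Variables (K : fieldType) (Gamma : quiver) (L : monomial_ring K Gamma).
Local Notation ar a := (cls (apath a) : L).
Hypothesis acyclic : triangular Gamma.
Variable p : qpath Gamma.

Lemma vrangeP i j v : reflect
  (exists2 k, (i <= k < j)%N && (k <= plen p)%N & pvert p k = v) (v \in vrange p i.+1 j).
Proof.
apply: (iffP (nthP (pstart p))) => -[k].
  rewrite size_drop size_take_min pverts_size /= ltn_subRL leq_min => /andP[lt_j lt_p].
  rewrite nth_drop nth_take // => e; exists (i + k)%N => //.
  by rewrite leq_addr lt_j -ltnS lt_p.
move=> /andP[/andP[le_i lt_j] le_p] <-; exists (k - i)%N.
  have lt_k : (k < minn j (plen p).+1)%N by rewrite leq_min lt_j.
  by rewrite size_drop size_take_min pverts_size ltn_sub2r // (leq_ltn_trans le_i).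
by rewrite nth_drop subnKC // nth_take.
Qed.

Lemma vrange1 v : (v \in vrange p 1 (size (pverts p))) = (v \in pverts p).
Proof. by rewrite /vrange take_size drop0. Qed.

(** When [i = 0] the product is 1, while [ptake 0 p] is a vertex; multiplication
    by [b] absorbs the difference. *)
Lemma ar_walk b i : src b = pvert p i -> (i <= plen p)%N ->
  ar b * \prod_(a <- rev (drop 0 (take (pos p (src b)).-1 (parrows p)))) ar a =
  ar b * cls (ptake i p).
Proof.
move=> sb le_i; rewrite /pos sb (index_pvert acyclic) //= drop0.
rewrite -[ar b in LHS](cls_e_pstart L (apath b)) -mulrA; congr (_ * _).
rewrite -(cls_prodl L (ptake i p)) pend_ptake // -sb //.
Qed.

Lemma walk_ar b c i : tgt c = pvert p i -> (i <= plen p)%N ->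
  ar b * (\prod_(a <- rev (drop (pos p (tgt c)).-1 (take (plen p) (parrows p)))) ar a) * ar c =
  ar b * cls (pdrop i p) * ar c.
Proof.
move=> tc le_i; rewrite /pos tc (index_pvert acyclic) //= take_size -!mulrA; congr (_ * _).
rewrite -{1}(e_cls_pend L (apath c)) mulrA; congr (_ * _).
rewrite -(cls_prodr L (pdrop i p)) pstart_pdrop // -tc //.
Qed.

Lemma parrows_ends a : a \in parrows p -> src a \in pverts p /\ tgt a \in pverts p.
Proof.
move=> ap; have lt_i : (index a (parrows p) < plen p)%N by rewrite index_mem.
by have [-> ->] := parrow_ends ap; split; apply: mem_pvert => //; apply: ltnW.
Qed.

Lemma no_exitP : no_exit L p <->
  (forall b, b \in arrowsB p ->
     ar b * \prod_(a <- rev (drop 0 (take (pos p (src b)).-1 (parrows p)))) ar a = 0) /\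
  (forall d, d \in arrowsD p ->
     ar d * \prod_(a <- rev (drop 0 (take (pos p (src d)).-1 (parrows p)))) ar a = 0).
Proof.
split=> [noexit|[hB hD] a i nap lt_i sa].
  split=> [b|d]; rewrite inE !vrange1.
    move=> /andP[/vrangeP[i /andP[/andP[_ lt_i] le_i] sb] tb].
    have {}lt_i : (i < plen p)%N by move: lt_i; rewrite pverts_size.
    rewrite (ar_walk (esym sb)) //; apply: noexit => //.
    by apply: contraNN tb => /parrows_ends[].
  move=> /and3P[/pvertP[i le_i sd] /pvertP[j le_j td] nd].
  rewrite (ar_walk (esym sd)) //; apply: noexit => //.
  exact: leq_trans (arrow_up acyclic le_i le_j (esym sd) (esym td)) le_j.
rewrite -(ar_walk sa (ltnW lt_i)).
have [ta|ta] := boolP (tgt a \in pverts p).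
  by apply: hD; rewrite inE !vrange1 nap ta sa mem_pvert // ltnW.
apply: hB; rewrite inE vrange1 ta andbT; apply/vrangeP; exists i => //.
by rewrite pverts_size /= lt_i ltnW.
Qed.

Lemma no_entryP : no_entry L p <->
  (forall b', b' \in arrowsB' p -> ar b' * cls p != 0 ->
     (forall c, c \in arrowsC p -> ar b' *
        (\prod_(a <- rev (drop (pos p (tgt c)).-1 (take (plen p) (parrows p)))) ar a) * ar c = 0) /\
     (forall d, d \in arrowsD p -> ar b' *
        (\prod_(a <- rev (drop (pos p (tgt d)).-1 (take (plen p) (parrows p)))) ar a) * ar d = 0)).
Proof.
split=> [noentry b|hB b sb nb c i nc /andP[i_gt0 le_i] tc].
  rewrite inE => /eqP sb nb; split=> [c|d]; rewrite inE !vrange1.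
    move=> /andP[sc /vrangeP[i /andP[/andP[i_gt0 _] le_i] tc]].
    rewrite (walk_ar b (esym tc)) //; apply: noentry; rewrite ?i_gt0 //.
    by apply: contraNN sc => /parrows_ends[].
  move=> /and3P[/pvertP[i le_i sd] /pvertP[j le_j td] nd].
  rewrite (walk_ar b (esym td)) //; apply: noentry; rewrite ?le_j ?andbT //.
  exact: leq_ltn_trans (arrow_up acyclic le_i le_j (esym sd) (esym td)).
rewrite -(walk_ar b tc le_i).
have [|hC hD] := hB b _ nb; first by rewrite inE sb.
have [sc|sc] := boolP (src c \in pverts p).
  by apply: hD; rewrite inE !vrange1 sc nc tc mem_pvert.
apply: hC; rewrite inE vrange1 sc; apply/vrangeP; exists i => //.
by rewrite i_gt0 pverts_size ltnS le_i.
Qed.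

End Conditions.

(** * Monomial algebras *)

Section MonomialIdeal.
Variables (K : fieldType) (Gamma : quiver) (I : twosided (path_algebra K Gamma)).
Local Notation A := (path_algebra K Gamma).

Lemma path_eltM (q p : qpath Gamma) : path_elt K q * path_elt K p = pcomp_elt K q p.
Proof. exact: pa_mulUU. Qed.

Lemma mcoeff_path (p q : qpath Gamma) : (path_elt K p : A)@_q = (p == q)%:R.
Proof. by rewrite path_elt.unlock mcoeffU. Qed.

(** The span of the paths in [I]. *)
Definition path_part : A -> bool :=
  fun x => `[< forall q, path_elt K q \notin I -> x@_q = 0 >].

Fact path_part_closed : zmod_closed path_part.
Proof.
split=> [|x y /asboolP hx /asboolP hy]; apply/asboolP => q qI.
  by rewrite mcoeff0.
by rewrite mcoeffB hx // hy // subrr.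
Qed.
HB.instance Definition _ := GRing.isZmodClosed.Build A path_part path_part_closed.

Lemma path_part_scale k x : x \in path_part -> k *: x \in path_part.
Proof. by move=> /asboolP hx; apply/asboolP => q qI; rewrite mcoeffZ hx // mulr0. Qed.

Lemma path_part_ind (Q : A -> Prop) : Q 0 ->
  (forall y z, Q y -> Q z -> Q (y + z)) ->
  (forall k p, path_elt K p \in I -> Q (k *: path_elt K p)) ->
  forall x, x \in path_part -> Q x.
Proof.
move=> Q0 QD QI x /asboolP hx; rewrite (path_eltE x).
apply: big_ind => // p _; have [pI|pI] := boolP (path_elt K p \in I); first exact: QI.
by rewrite hx // scale0r.
Qed.

Lemma path_part_path (p : qpath Gamma) : path_elt K p \in I -> path_elt K p \in path_part.
Proof.
move=> pI; apply/asboolP => q qI; rewrite mcoeff_path; case: eqP => // e.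
by rewrite -e pI in qI.
Qed.

Lemma path_part_comp (q p : qpath Gamma) : path_elt K q * path_elt K p \in I ->
  path_elt K q * path_elt K p \in path_part.
Proof.
rewrite path_eltM /pcomp_elt; case: (Defs.pcomp q p) => [r|] /=; last by rewrite !rpred0.
exact: path_part_path.
Qed.

Fact path_part_mull a x : x \in path_part -> a * x \in path_part.
Proof.
move=> hx; elim/pa_ind: a => [|a b ha hb|k q].
- by rewrite mul0r rpred0.
- by rewrite mulrDl rpredD.
have -> : k *: path_elt K q * x = k *: (path_elt K q * x) by rewrite [RHS]pa_scaleAl.
apply: path_part_scale; move: x hx; apply: path_part_ind => [|y z hy hz|l p pI].
- by rewrite mulr0 rpred0.
- by rewrite mulrDr rpredD.
have -> : path_elt K q * (l *: path_elt K p) = l *: (path_elt K q * path_elt K p).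
  by rewrite [RHS]pa_scaleAr.
by apply/path_part_scale/path_part_comp/ideal_mull.
Qed.

Fact path_part_mulr a x : x \in path_part -> x * a \in path_part.
Proof.
move=> hx; elim/pa_ind: a => [|a b ha hb|k q].
- by rewrite mulr0 rpred0.
- by rewrite mulrDr rpredD.
have -> : x * (k *: path_elt K q) = k *: (x * path_elt K q) by rewrite [RHS]pa_scaleAr.
apply: path_part_scale; move: x hx; apply: path_part_ind => [|y z hy hz|l p pI].
- by rewrite mul0r rpred0.
- by rewrite mulrDl rpredD.
have -> : (l *: path_elt K p) * path_elt K q = l *: (path_elt K p * path_elt K q).
  by rewrite [RHS]pa_scaleAl.
by apply/path_part_scale/path_part_comp/ideal_mulr.
Qed.
HB.instance Definition _ :=
  isTwoSidedIdeal.Build A path_part path_part_mull path_part_mulr.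

Hypothesis mono : monomial I.

(** As [path_part] is an ideal, it contains [I] once it contains generators of [I]. *)
Lemma monomial_coef x q : x \in I -> path_elt K q \notin I -> x@_q = 0.
Proof.
pose S : twosided A := HB.pack_for (twosided A) path_part.
case: mono => X XI /XI xI qI; suff /asboolP : x \in path_part by apply.
apply: (xI S) => _ [p Xp ->]; apply: path_part_path.
by apply/XI => S' hS'; apply: hS'; exists p.
Qed.

Local Notation Lambda := (rquot I).

Lemma rpi_0 : rpi I 0 = 0.
Proof. by apply/eqP; rewrite rpi_eq0 rpred0. Qed.

Lemma rpi_mul x y : rpi I (x * y) = rpi I x * rpi I y.
Proof. exact/esym/rpiM. Qed.

Definition rquot_scalar (k : K) : Lambda := rpi I (k *: pa_one K Gamma).

Lemma rquot_scalar_mul k x : rquot_scalar k * rpi I x = rpi I (k *: x).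
Proof.
rewrite -rpi_mul; congr rpi.
rewrite -[LHS](pa_scaleAl k (pa_one K Gamma)); congr (_ *: _); exact: mul1r.
Qed.

Fact rquot_scalar_additive : zmod_morphism rquot_scalar.
Proof.
move=> k l; apply/eqP; rewrite eq_sym subr_eq; apply/eqP.
by rewrite -rpiD -scalerDl subrK.
Qed.
Fact rquot_scalar_multiplicative : monoid_morphism rquot_scalar.
Proof.
split=> [|k l]; first by rewrite /rquot_scalar scale1r.
by rewrite rquot_scalar_mul scalerA.
Qed.
HB.instance Definition _ :=
  GRing.isZmodMorphism.Build K Lambda rquot_scalar rquot_scalar_additive.
HB.instance Definition _ :=
  GRing.isMonoidMorphism.Build K Lambda rquot_scalar rquot_scalar_multiplicative.

Fact rquot_scalarC k (x : Lambda) : rquot_scalar k * x = x * rquot_scalar k.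
Proof.
have [y ->] := rpi_surj x; rewrite rquot_scalar_mul -rpi_mul; congr rpi.
rewrite -[RHS](pa_scaleAr k y (pa_one K Gamma)); congr (_ *: _); exact/esym/mulr1.
Qed.

Fact path_cls_comp (q p r : qpath Gamma) : pend p = pstart q -> pstart r = pstart p ->
  parrows r = parrows p ++ parrows q -> path_cls I q * path_cls I p = path_cls I r.
Proof.
move=> e sr ar; rewrite /path_cls -rpi_mul path_eltM; congr (rpi I _).
rewrite /pcomp_elt; case: (pcompP q p) => [s _ ss _ as_|]; last by rewrite e eqxx.
by congr path_elt; apply: qpath_eq; rewrite ?ss ?sr // as_ ar.
Qed.

Fact path_cls_comp0 (q p : qpath Gamma) : pend p != pstart q ->
  path_cls I q * path_cls I p = 0.
Proof.
move=> ne; rewrite /path_cls -rpi_mul path_eltM.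
rewrite /pcomp_elt; case: (pcompP q p) => [s e|_]; first by rewrite e eqxx in ne.
exact: rpi_0.
Qed.

Fact path_cls_sum : \sum_v path_cls I (vpath v) = 1.
Proof. by rewrite /path_cls -(big_morph (rpi I) (@rpiD _ I) rpi_0). Qed.

Fact path_cls_span (Q : Lambda -> Prop) : Q 0 ->
  (forall x y, Q x -> Q y -> Q (x + y)) ->
  (forall k p, Q (rquot_scalar k * path_cls I p)) -> forall x, Q x.
Proof.
move=> Q0 QD Qp x; have [y ->] := rpi_surj x.
elim/pa_ind: y => [|y z hy hz|k p].
- by rewrite rpi_0.
- by rewrite rpiD; apply: QD.
- by rewrite -rquot_scalar_mul; apply: Qp.
Qed.

Fact path_cls_coef q : path_cls I q != 0 -> exists f : Lambda -> K,
  {morph f : x y / x + y} /\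
  forall k r, f (rquot_scalar k * path_cls I r) = if r == q then k else 0.
Proof.
rewrite rpi_eq0 => qI; pose f (x : Lambda) : K := (repr (x : Quotient.quot I) : A)@_q.
have fE x : f (rpi I x) = x@_q.
  apply/eqP; rewrite -subr_eq0 -mcoeffB; apply/eqP/monomial_coef => //.
  by rewrite -rpi_eq /rpi reprK.
exists f; split=> [x y|k r].
  have [a ->] := rpi_surj x; have [b ->] := rpi_surj y.
  by rewrite -rpiD !fE mcoeffD.
by rewrite rquot_scalar_mul fE mcoeffZ mcoeff_path; case: eqP; rewrite ?mulr1 ?mulr0.
Qed.

Definition monomial_rquot : monomial_ring K Gamma :=
  @MonomialRing K Gamma Lambda rquot_scalar (path_cls I) rquot_scalarC
    path_cls_comp path_cls_comp0 path_cls_sum path_cls_span path_cls_coef.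

End MonomialIdeal.

Theorem theorem5p1 (K : fieldType) (Gamma : quiver)
    (I : twosided (path_algebra K Gamma))
    (hadm : admissible I) (hmon : monomial I) (htri : triangular Gamma)
    (U : lmodType (rquot I)) (hfg : fin_gen U) (hU : uniserial U)
    (p : qpath Gamma) (hp : mast p U) :
  irreducible_map (rad_incl U) <->
  [/\ ~ simple_module U,
      (forall b, b \in arrowsB p ->
         arrow_cls I b * alphas I p (pos p (src b)).-1 1 = 0) /\
      (forall d, d \in arrowsD p ->
         arrow_cls I d * alphas I p (pos p (src d)).-1 1 = 0)
    & forall b', b' \in arrowsB' p -> arrow_cls I b' * path_cls I p != 0 ->
        (forall c, c \in arrowsC p ->
           arrow_cls I b' * alphas I p (plen p) (pos p (tgt c)) * arrow_cls I c = 0) /\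
        (forall d, d \in arrowsD p ->
           arrow_cls I b' * alphas I p (plen p) (pos p (tgt d)) * arrow_cls I d = 0)].
Proof.
pose L := monomial_rquot hmon; case: hp => lenU px.
have exitP := no_exitP L htri p; have entryP := no_entryP L htri p.
split=> [/(@irreducible_inclusionP K Gamma L htri U p lenU px)[ns noexit noentry]|].
  by split=> //; [apply/exitP|apply/entryP].
move=> [ns /exitP noexit /entryP noentry].
by apply/(@irreducible_inclusionP K Gamma L htri U p lenU px).
Qed.
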